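(* Let $H$ (the Hamiltonian) and $Q$ (the charge) be self-adjoint operators on a Hilbert space, let $\langle\cdot\rangle$ denote the expectation in the initial quantum state, and put $Q(t)=e^{iHt}Qe^{-iHt}$ and $I(t)=\frac{dQ(t)}{dt}$. For $t>0$ let the moments $\langle(\Delta Q)^k\rangle$ be defined by the generating function $$\chi(\lambda,t)=\big\langle e^{i\lambda Q(t)}e^{-i\lambda Q}\big\rangle=\sum_{k=0}^{\infty}\frac{(i\lambda)^k}{k!}\langle(\Delta Q)^k\rangle .$$ Assume that all operators arising are properly defined. Then for every $k\ge 1$ $$\langle(\Delta Q)^k\rangle=\int_0^t\!\cdots\!\int_0^t dt_1\cdots dt_k\,\big\langle \mathrm{T}^*\big(I(t_1)\cdots I(t_k)\big)\big\rangle ,$$ where $$\mathrm{T}^*\big(I(t_1)\cdots I(t_k)\big):=\frac{\partial}{\partial t_k}\cdots\frac{\partial}{\partial t_1}\,\mathrm{T}\big(Q(t_1)\cdots Q(t_k)\big).$$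
   Context: $\mathrm{T}$ is the usual time ordering: $\mathrm{T}(A_1\cdots A_k)$, for operators $A_i$ associated with times $t_i$, is the product of the $A_i$ arranged so that operators with later times stand to the left of those with earlier times. In $\mathrm{T}(Q(t_1)\cdots Q(t_k))$ there is no ambiguity at coinciding times, since $Q(t_i)=Q(t_j)$ when $t_i=t_j$. The derivatives in the definition of $\mathrm{T}^*$ are taken after the time ordering, in the sense of distributions in $(t_1,\dots,t_k)$, so $\mathrm{T}^*(I(t_1)\cdots I(t_k))$ may contain terms supported at coinciding times, and these are included in the integral over $[0,t]^k$. Standing assumption: all operators arising (the $Q(t)$, their time-ordered products, the derivatives, and the power series expansion of $\chi$ in $\lambda$) are assumed to be properly defined. *)

(* Defs.v *)
From HB Require Import structures.
From mathcomp Require Import all_boot all_order all_algebra.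
From mathcomp Require Import complex.
From mathcomp Require Import all_classical all_reals all_analysis.

Set Implicit Arguments.
Unset Strict Implicit.
Unset Printing Implicit Defensive.

Import Order.TTheory GRing.Theory Num.Theory.
Import numFieldNormedType.Exports.

Local Open Scope classical_set_scope.
Local Open Scope ring_scope.

(* The complex numbers with their usual topology: the regular module [R[i]^o]
   is where the library puts the topology on [R[i]]. *)
Notation Cplx R := ((complex R)^o).

(** ** Unbounded operators on a Hilbert space

    A Hilbert space is a complete normed module [V] over [R[i]] with an inner
    product [ip : {dot V for Num.conj}] inducing its norm. Such forms are linear
    in the FIRST argument, so the physicist's <x| A y> is [ip (A y) x]. *)

(* The values of [app] outside [dom] are irrelevant. *)
Record operator (V : Type) := Op { dom : set V; app :> V -> V }.

Section Operators.
Context {R : realType} {V : completeNormedModType R[i]}.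
Context (ip : {dot V for Num.conj}).
Implicit Types (A B : operator V) (U : R -> V -> V).

Definition hilbert := forall x : V, ip x x = `|x| ^+ 2.

Definition totalop (f : V -> V) : operator V := Op [set: V] f.

Definition compop A B : operator V :=
  Op [set x | dom B x /\ dom A (B x)] (A \o B).

Definition oppop A : operator V := Op (dom A) (fun x => - A x).

Definition linop A :=
  dom A 0 /\
  forall (a : R[i]) x y, dom A x -> dom A y ->
    dom A (a *: x + y) /\ A (a *: x + y) = a *: A x + A y.

Definition in_adjoint_graph A (x y : V) :=
  forall z, dom A z -> ip (A z) x = ip z y.

Definition selfadjoint A :=
  [/\ linop A, dense (dom A) &
      forall x y, in_adjoint_graph A x y <-> dom A x /\ A x = y].

Definition unitary_group U :=
  [/\ forall s, linear (U s),
      forall s x y, ip (U s x) (U s y) = ip x y,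
      forall x, U 0 x = x,
      forall s r x, U (s + r) x = U s (U r x) &
      forall x, continuous (U ^~ x)].

(* [U s] = exp(i s A): the strongly continuous unitary group whose generator,
   domain included, is [A]. For self-adjoint [A] there is exactly one such
   group, by Stone's theorem. *)
Definition is_expi A U :=
  unitary_group U /\
  forall x y, (dom A x /\ A x = y) <->
    (fun s : R => (s^-1)%:C%C *: (U s x - x)) @ 0^' --> 'i%C *: y.

Definition expi_exists A := exists U, is_expi A U.

Definition expi A : R -> V -> V := 
  xget ((fun=> id) : R -> V -> V) [set U | is_expi A U].

(* Q(t) = exp(iHt) Q exp(-iHt) *)
Definition heisenberg (H Q : operator V) (t : R) : operator V :=
  compop (totalop (expi H t)) (compop Q (totalop (expi H (- t)))).

(** ** States

    A quantum state (density operator rho) is given by a sequence [v] of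
    unnormalized vectors, rho = \sum_n |v_n><v_n|. A pure state has only one
    nonzero [v_n]. *)

Definition state (v : nat -> V) :=
  series (fun n => ip (v n) (v n) : Cplx R) @ \oo --> (1 : Cplx R).

(* <A> = tr (rho A) = \sum_n <v_n| A v_n> *)
Definition expect (v : nat -> V) A : Cplx R :=
  limn (series (fun n => ip (A (v n)) (v n) : Cplx R)).

(* chi(lambda, t) *)
Definition charge_gf (v : nat -> V) (H Q : operator V) (t l : R) : Cplx R :=
  expect v (compop (totalop (expi (heisenberg H Q t) l))
                   (totalop (expi Q (- l)))).

(* chi(lambda) = \sum_k (i lambda)^k / k! m_k near lambda = 0, which determines
   the moments [m]. *)
Definition has_moments (chi : R -> Cplx R) (m : nat -> R[i]) :=
  \forall l \near (0 : R),
    series (fun k => ('i%C * l%:C%C) ^+ k / k`!%:R * m k : Cplx R) @ \oo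
      --> chi l.

(** ** Time ordering *)

(* [A i] is associated with the time [tau i]; later times stand to the left. *)
Definition time_ordered k (A : 'I_k -> operator V) (tau : 'I_k -> R) :
    operator V :=
  \big[compop/totalop id]_(i <- sort (fun i j => tau j <= tau i) (enum 'I_k))
    A i.

(* T(Q(tau_1) ... Q(tau_k)) as a function of tau in R^k *)
Definition TQ k (Qt : R -> operator V) (tau : 'rV[R]_k) : operator V :=
  time_ordered (fun i => Qt (tau ord0 i)) (tau ord0).

End Operators.

(** ** Distributions on R^k *)

Section Distributions.
Context {R : realType}.

Definition cube k (M : R) : set 'rV[R]_k :=
  [set tau | forall i, `|tau ord0 i| <= M].

Definition pderiv k (i : 'I_k) (phi : 'rV[R]_k -> R) : 'rV[R]_k -> R :=
  fun tau => 'D_(delta_mx ord0 i) phi tau.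

Fixpoint Cn k (n : nat) (phi : 'rV[R]_k -> R) : Prop :=
  continuous phi /\
  if n is n'.+1 then
    forall i, (forall tau, derivable phi tau (delta_mx ord0 i)) /\
              Cn n' (pderiv i phi)
  else True.

(* By linearity it is enough to test against real functions. *)
Definition test_function k (phi : 'rV[R]_k -> R) :=
  (forall n, Cn n phi) /\
  exists M : R, forall tau, ~ cube M tau -> phi tau = 0.

(* The Lebesgue integral over R^k as an iterated integral; it is only applied to
   compactly supported functions that are meant to be continuous. *)
Fixpoint integral_rV k : ('rV[R]_k -> R) -> R :=
  match k with
  | 0 => fun f => f 0
  | k'.+1 => fun f =>
      \int[lebesgue_measure]_(x in [set: R])
        integral_rV (fun tau : 'rV_k' => f (row_mx (const_mx x : 'rV_1) tau))
  end.

Definition cintegral_rV k (f : 'rV[R]_k -> R[i]) : R[i] :=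
  (integral_rV (fun tau => complex.Re (f tau)) +i*
   integral_rV (fun tau => complex.Im (f tau)))%C.

(* R^k with its Borel sets *)
Definition borel_rV k := g_sigma_algebraType (@open 'rV[R]_k).

Definition cintegral k (nu : {measure set (borel_rV k) -> \bar R})
    (D : set 'rV[R]_k) (f : 'rV[R]_k -> R[i]) : R[i] :=
  ((\int[nu]_(tau in D) complex.Re (f tau)) +i*
   (\int[nu]_(tau in D) complex.Im (f tau)))%C.

(* [h] is locally [nu]-integrable, i.e. h d[nu] is a complex Radon measure. Any
   complex Radon measure is of this form (polar decomposition). *)
Definition radon_density k (nu : {measure set (borel_rV k) -> \bar R})
    (h : 'rV[R]_k -> R[i]) :=
  forall M : R,
    nu.-integrable (cube M) (fun tau => (complex.Re (h tau))%:E) /\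
    nu.-integrable (cube M) (fun tau => (complex.Im (h tau))%:E).

(* The scalar distribution [u] is the complex Radon measure h d[nu]; its
   integral over a compact [D] is then [cintegral nu D h]. *)
Definition distribution_is_measure k (u : ('rV[R]_k -> R) -> R[i])
    (nu : {measure set (borel_rV k) -> \bar R}) (h : 'rV[R]_k -> R[i]) :=
  radon_density nu h /\
  forall phi, test_function phi ->
    u phi = cintegral nu [set: 'rV[R]_k] (fun tau => (phi tau)%:C%C * h tau).

Definition time_box k (t : R) : set 'rV[R]_k :=
  [set tau | forall i, 0 <= tau ord0 i <= t].

Context {V : completeNormedModType R[i]} (ip : {dot V for Num.conj}).

(* [y] is the weak integral of phi(tau) F(tau) x over R^k. *)
Definition weak_integral k (F : 'rV[R]_k -> operator V) (phi : 'rV[R]_k -> R)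
    (x y : V) :=
  forall z, ip y z = cintegral_rV (fun tau => (phi tau)%:C%C * ip (F tau x) z).

(* Operator-valued distributions map test functions to operators. The function
   [F] defines the distribution phi |-> \int phi(tau) F(tau) dtau. *)
Definition regular_distribution k (F : 'rV[R]_k -> operator V)
    (phi : 'rV[R]_k -> R) : operator V :=
  Op [set x | (forall tau, dom (F tau) x) /\ exists y, weak_integral F phi x y]
     (fun x => xget 0 (weak_integral F phi x)).

Definition distr_deriv k (i : 'I_k) (u : ('rV[R]_k -> R) -> operator V) :
    ('rV[R]_k -> R) -> operator V :=
  fun phi => oppop (u (pderiv i phi)).

(* T*(I(t_1) ... I(t_k)) = d/dt_k ... d/dt_1 T(Q(t_1) ... Q(t_k)); [foldl] takes
   the derivative d/dt_1 first. It depends only on Q, and k = 1 gives I = dQ/dt. *)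
Definition Tstar k (Qt : R -> operator V) : ('rV[R]_k -> R) -> operator V :=
  foldl (fun u i => distr_deriv i u) (regular_distribution (TQ Qt))
        (enum 'I_k).

(** ** Well-definedness of the operators involved *)

(* The products T(Q(t_1) ... Q(t_k)) act on the state, depend weakly continuously
   on the times, and have an expectation, the series <T(Q(t_1) ... Q(t_k))>
   being normally convergent locally uniformly in the times. The last property
   follows from the first two for a pure state, and for a finite mixture. *)
Definition TQ_well_defined (v : nat -> V) (Qt : R -> operator V) :=
  forall k : nat,
  [/\ forall n (tau : 'rV[R]_k), dom (TQ Qt tau) (v n),
      forall n z, continuous (fun tau : 'rV[R]_k =>
                    ip (TQ Qt tau (v n)) z : Cplx R) &
      forall M : R, exists2 b : nat -> R, cvgn (series b) &
        forall n (tau : 'rV[R]_k), cube M tau ->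
          `|ip (TQ Qt tau (v n)) (v n)| <= (b n)%:C%C].

(* The derivatives T*, smeared with test functions, act on the state. *)
Definition Tstar_well_defined (v : nat -> V) (Qt : R -> operator V) :=
  forall k (phi : 'rV[R]_k -> R), test_function phi ->
  forall n, dom (Tstar Qt phi) (v n).

End Distributions.

(* Main.v *)
Require Import Defs.
From HB Require Import structures.
From mathcomp Require Import all_boot all_order all_algebra.
From mathcomp Require Import complex ring lra.
From mathcomp Require Import all_classical all_reals all_analysis.
From mathcomp Require Import measurable_realfun.

Set Implicit Arguments.
Unset Strict Implicit.
Unset Printing Implicit Defensive.

Import Order.TTheory GRing.Theory Num.Theory.
Import numFieldNormedType.Exports.

Local Open Scope classical_set_scope.
Local Open Scope ring_scope.

(** Put g(tau) = <T(Q(tau_1) ... Q(tau_k))>. Testing the measure T* against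
    products of smooth cut-offs of [0, t] turns the integral of T* over the
    closed box into integrals of g against k-fold products of (-psi'), where
    -psi' is an approximate delta at t minus an approximate delta at 0; as g is
    continuous, the limit is the alternating sum of g over the corners of
    [0, t]^k. At a corner, time ordering puts every Q(t) to the left of every
    Q(0), so this sum is
      \sum_b (-1)^b C(k, b) <Q(t)^(k-b) Q^b>.
    On the other hand, Taylor expansion of both exponentials in
    chi = \sum_n <exp(-i l Q(t)) v_n | exp(-i l Q) v_n> produces the same
    numbers as coefficients of (i l)^k / k!, up to an error O(l^(k+1)) that is
    summable over the vectors v_n because |Q^b v|^2 = <v| Q^(2b) v>. *)

(** * Smooth steps *)

Section SmoothStep.
Context {R : realType}.
Implicit Types (f g : R -> R) (p : {poly R}).

(** The box is closed and T* may charge its faces, so the cut-offs equal 1 on all of [0, t] and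
    their slopes lie on the outer sides [-eps, 0] and [t, t + eps]; they tend pointwise to the
    indicator of the closed box, and dominated convergence applies. The order imposed by T at the
    corners agrees with the order of the exponentials in chi, so the noncommuting factors never have
    to be exchanged. Since Q is unbounded and the v_n need not be analytic vectors, the exponential
    series need not converge on them. Only Taylor polynomials with a remainder are available, and
    the moments are identified by comparing two expansions of chi at l = 0 to every finite order. In
    a mixed state each limit must moreover be exchanged with the sum over n; the summable majorants
    in [TQ_well_defined], uniform for bounded times, make this possible on both sides. *)

Lemma is_derive1P f (x d : R) :
  is_derive x (1 : R) f d <-> h^-1 * (f (h + x) - f x) @[h --> 0^'] --> d.
Proof.
split.
  move=> [df dE]; rewrite -dE; move: df; rewrite /derivable /derive => df.
  have -> : (fun h => h^-1 * (f (h + x) - f x)) =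
     (fun h => h^-1 *: ((f \o shift x) (h *: (1 : R)) - f x)).
    by apply/funext => h; rewrite /= /GRing.scale/= mulr1.
  exact: df.
have -> : (fun h => h^-1 * (f (h + x) - f x)) =
     (fun h => h^-1 *: ((f \o shift x) (h *: (1 : R)) - f x)).
  by apply/funext => h; rewrite /= /GRing.scale/= mulr1.
move=> fd; split; last exact: cvg_lim.
by apply/cvg_ex; exists d.
Qed.

Lemma near_is_derive1 f g (x d : R) :
  (\forall y \near x, f y = g y) -> is_derive x (1 : R) f d -> is_derive x (1 : R) g d.
Proof.
move=> fg /is_derive1P fd; apply/is_derive1P.
apply: cvg_trans fd; apply: near_eq_cvg.
have fgx := nbhs_singleton fg.
rewrite fgx; apply: cvg_within.
have : \forall h \near (0 : R), f (h + x) = g (h + x).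
  have : (h + x) @[h --> (0 : R)] --> x.
    by rewrite -{2}(add0r x); apply: cvgD; [exact: cvg_id | exact: cvg_cst].
  by move/(_ _ fg).
by apply: filterS => h ->.
Qed.

Lemma poly_le_expr p : exists C n, 0 <= C /\
  forall y : R, 1 <= y -> `|p.[y]| <= C * y ^+ n.
Proof.
elim/poly_ind: p => [|p c [C [n [C0 IH]]]].
  by exists 0, 0%N; split => // y _; rewrite horner0 normr0 mul0r.
exists (C + `|c|), n.+1; split; first exact: addr_ge0.
move=> y y1; have y0 : 0 <= y by exact: le_trans y1.
rewrite hornerD hornerM hornerX hornerC.
rewrite (le_trans (ler_normD _ _))// mulrDl lerD//.
  by rewrite normrM (ger0_norm y0) exprSr mulrA ler_wpM2r// IH.
by rewrite ler_peMr// exprn_ege1.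
Qed.

(** The classical function exp(-1/x), flat at 0. The polynomial factor in 1/x makes the family
    closed under differentiation, so that smoothness becomes an induction over all [p] at once. *)
Definition flat p (x : R) : R :=
  if 0 < x then p.[x^-1] * expR (- x^-1) else 0.

(** With y = 1/x, exp(y) >= y^(n+2) / (n+2)! beats the growth y^n of the polynomial by two powers. A
    quadratic bound is what forces the difference quotient at 0 to vanish. *)
Lemma flat_le_sqr p : exists2 C, 0 <= C &
  forall x, x <= 1 -> `|flat p x| <= C * x ^+ 2.
Proof.
have [C [n [C0 Cp]]] := poly_le_expr p.
exists (C * n.+2`!%:R); first by rewrite mulr_ge0.
move=> x x1; rewrite /flat; case: ltP => x0; last first.
  by rewrite normr0; apply: mulr_ge0; [exact: mulr_ge0 | exact: sqr_ge0].
have y1 : 1 <= x^-1 by rewrite invf_ge1.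
have y0 : 0 <= x^-1 by exact: le_trans y1.
rewrite normrM (ger0_norm (expR_ge0 _)) expRN.
apply: (le_trans (ler_wpM2r _ (Cp _ y1))); first by rewrite invr_ge0 expR_ge0.
rewrite -!mulrA ler_wpM2l//.
rewrite -ler_pdivlMl ?exprn_gt0 ?invr_gt0// -exprVn invrK.
rewrite mulrA [x ^+ n * _]mulrC -mulrA -exprD addn2 -[x in leRHS]invrK exprVn.
have := @expR_ge1Dxn R x^-1 n.+1 y0.
have f0 : 0 < n.+2`!%:R :> R by rewrite ltr0n fact_gt0.
have xn0 : 0 < x^-1 ^+ n.+2 by rewrite exprn_gt0// invr_gt0.
move=> le1; rewrite -ler_pV2 ?inE ?unitfE ?expR_gt0 ?lt0r_neq0 ?mulr_gt0 ?invr_gt0 ?expR_gt0//.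
rewrite !invrK invfM invrK mulrC (le_trans _ le1)// lerDr//.
Qed.

Lemma is_derive_horner p (x : R) : is_derive x (1 : R) (horner p) p^`().[x].
Proof.
elim/poly_ind: p => [|p c IH].
  rewrite linear0 horner0 (_ : horner 0 = cst 0); first exact: is_derive_cst.
  by apply/funext => y; rewrite horner0.
have dM := is_deriveM IH (is_derive_id x (1 : R)).
have dD := is_deriveD dM (is_derive_cst (c : R) x (1 : R)).
rewrite (_ : horner _ = (horner p : R -> R) * id + cst c); last first.
  by apply/funext => y; rewrite !hornerE.
rewrite (_ : _.[x] = p.[x] *: (1:R) + x *: (p^`()).[x] + 0); first exact: dD.
by rewrite derivD derivM derivX derivC !hornerE /GRing.scale/= mulr1 mulrC addrC.
Qed.

(** For x > 0 this is the chain rule in y = 1/x, where dy/dx = - y^2 produces the factor X^2 and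
    exp(-y) the combination p - p'. At 0 the quadratic bound gives derivative 0. *)
Lemma is_derive_flat p (x : R) : is_derive x (1 : R) (flat p) (flat ('X^2 * (p - p^`())) x).
Proof.
have [x0|x0|->] := ltgtP x 0.
- have -> : flat ('X^2 * (p - p^`())) x = 0 by rewrite /flat (lt_gtF x0).
  apply: (@near_is_derive1 (cst (0 : R))).
    near=> y; rewrite /flat/= lt_gtF//; near: y; exact: lt_nbhsl.
- apply: (@near_is_derive1 (fun x => p.[x^-1] * expR (- x^-1))).
    near=> y; rewrite /flat/= ifT//; near: y; exact: lt_nbhsr.
  have dV : is_derive x (1 : R) (@GRing.inv R) (- x ^- 2).
    have := @is_deriveV _ id x 1 1 (lt0r_neq0 x0) (is_derive_id x (1 : R)).
    by rewrite /GRing.scale/= mulr1.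
  have dp : is_derive x (1 : R) (fun x => p.[x^-1]) (p^`().[x^-1] * - x ^- 2).
    by apply: (@is_derive1_comp _ (horner p)); exact: is_derive_horner.
  have de : is_derive x (1 : R) (fun x => expR (- x^-1)) (expR (- x^-1) * x ^- 2).
    apply: (@is_derive1_comp _ expR).
    by rewrite -(opprK (x ^- 2)); exact: (is_deriveN dV).
  apply: (is_derive_eq (is_deriveM dp de)).
  rewrite /flat x0 /GRing.scale/= hornerM hornerXn hornerD hornerN exprVn; ring.
- have -> : flat ('X^2 * (p - p^`())) 0 = 0 by rewrite /flat ltxx.
  apply/is_derive1P.
  have [C C0 Cp] := flat_le_sqr p.
  apply/cvgrPdist_le => e e0.
  have Ce : 0 < e / (C + 1) by rewrite divr_gt0// ltr_wpDl.
  near=> h; rewrite addr0 {2}/flat ltxx subr0 sub0r normrN normrM normfV.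
  have h0 : h != 0 by near: h; exact: nbhs_dnbhs_neq.
  have h1 : h <= 1.
    by rewrite (le_trans (ler_norm h))//; near: h; exact: dnbhs0_le.
  rewrite ler_pdivrMl ?normr_gt0// (le_trans (Cp _ h1))//.
  rewrite -normr_id -(real_normK (num_real _))// normr_id expr2 mulrA mulrC.
  apply: ler_wpM2l => //.
  apply: (@le_trans _ _ ((C + 1) * `|h|)); first by rewrite ler_wpM2r// lerDl.
  rewrite -ler_pdivlMl ?ltr_wpDl// mulrC.
  by near: h; apply: dnbhs0_le.
Unshelve. all: by end_near.
Qed.

(** The derivative is an existential witness, so that closure proofs can exhibit it; [smooth_derive]
    identifies it with [derive1]. *)
Fixpoint diffn n f : Prop :=
  if n is n'.+1 then
    exists2 g, (forall x : R, is_derive x (1 : R) f (g x)) & diffn n' g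
  else True.

Definition smooth f := forall n, diffn n f.

Lemma smooth_derive f : smooth f ->
  (forall x : R, is_derive x (1 : R) f (derive1 f x)) /\ smooth (derive1 f).
Proof.
move=> sf; have uniq g : (forall x : R, is_derive x (1 : R) f (g x)) -> g = derive1 f.
  by move=> fg; apply/funext => x; rewrite derive1E; have [_ ->] := fg x.
split; first by have [g fg _] := sf 1%N; rewrite -(uniq _ fg).
by move=> n; have [g fg] := sf n.+1; rewrite (uniq _ fg).
Qed.

Lemma smooth_continuous f : smooth f -> continuous f.
Proof.
move=> /smooth_derive[df _] x; apply: differentiable_continuous.
by apply/derivable1_diffP; have [] := df x.
Qed.

Lemma diffnS n f : diffn n.+1 f -> diffn n f.
Proof. by elim: n f => // n IH f [g fg /IH]; exists g. Qed.

Lemma diffnD n f g : diffn n f -> diffn n g -> diffn n (f \+ g).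
Proof.
elim: n f g => // n IH f g [df fdf sdf] [dg gdg sdg].
exists (df \+ dg); last exact: IH.
by move=> x; exact: is_deriveD.
Qed.

Lemma diffnM n f g : diffn n f -> diffn n g -> diffn n (f \* g).
Proof.
elim: n f g => // n IH f g /[dup] /diffnS sf [df fdf sdf].
move=> /[dup] /diffnS sg [dg gdg sdg].
exists ((f \* dg) \+ (g \* df)).
  by move=> x; exact: is_deriveM.
by apply: diffnD; exact: IH.
Qed.

Lemma diffn_cst n (c : R) : diffn n (cst c).
Proof.
elim: n c => // n IH c; exists (cst 0) => // x; exact: is_derive_cst.
Qed.

Lemma diffn_affine n f a b : diffn n f -> diffn n (fun x => f (a * x + b)).
Proof.
elim: n f => // n IH f [df fdf sdf].
exists ((fun x => df (a * x + b)) \* cst a); last first.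
  by apply: diffnM; [exact: IH | exact: diffn_cst].
move=> x; apply: (@is_derive1_comp _ f (fun x => a * x + b)).
have d := is_deriveD (is_deriveZ a (is_derive_id x (1 : R)))
   (is_derive_cst (b : R) x (1 : R)).
by rewrite -[X in is_derive _ _ _ X]addr0 -[X in X + 0]mulr1.
Qed.

Lemma smoothD f g : smooth f -> smooth g -> smooth (f \+ g).
Proof. by move=> sf sg n; exact: diffnD. Qed.

Lemma smoothM f g : smooth f -> smooth g -> smooth (f \* g).
Proof. by move=> sf sg n; exact: diffnM. Qed.

Lemma smooth_affine f a b : smooth f -> smooth (fun x => f (a * x + b)).
Proof. by move=> sf n; exact: diffn_affine. Qed.

Lemma smooth_flat p : smooth (flat p).
Proof.
move=> n; elim: n p => // n IH p.
by exists (flat ('X^2 * (p - p^`()))) => // x; exact: is_derive_flat.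
Qed.

Lemma integrable_cpt f M : continuous f ->
  (forall x, M < `|x| -> f x = 0) ->
  lebesgue_measure.-integrable setT (EFin \o f).
Proof.
move=> cf f0.
have iM : lebesgue_measure.-integrable `[- M, M] (EFin \o f).
  apply: continuous_compact_integrable; first exact: segment_compact.
  exact: continuous_subspaceT.
rewrite (_ : EFin \o f = (EFin \o f) \_ `[- M, M]).
  by apply/(integrable_mkcond _ _).1 => //; exact: measurable_itv.
apply/funext => x; rewrite patchE; case: ifPn => //.
rewrite notin_setE/= in_itv/= => /negP; rewrite -ler_norml -ltNge => xM.
by rewrite f0.
Qed.

Lemma continuous_primitive f M : continuous f ->
  (forall x, M < `|x| -> f x = 0) ->
  exists F, forall x, is_derive x (1 : R) F (f x).
Proof.
move=> cf f0; have fi := integrable_cpt cf f0.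
exists (fun x => \int[lebesgue_measure]_(t in [set` `]-oo, x]]) f t)%R => x.
have [] := @continuous_FTC1 _ f (BInfty _ true) x (x + 1) _ _ _ (cf x).
- by rewrite ltrDl.
- by apply: integrableS fi => //; exact: measurable_itv.
- by rewrite ltNyr.
by move=> dF FE; split; [exact: dF | rewrite -derive1E; exact: FE].
Qed.

(** The normalized primitive of the bump exp(-1/x) exp(-1/(1-x)), which lives on (0, 1). *)
Lemma smooth_step : exists S : R -> R, [/\ smooth S,
  forall x, x <= 0 -> S x = 0, forall x, 1 <= x -> S x = 1,
  forall x, 0 <= derive1 S x & forall x, 0 <= S x <= 1].
Proof.
pose rho := flat 1 \* (fun x => flat 1 (-1 * x + 1)).
have srho : smooth rho.
  by apply: smoothM; [exact: smooth_flat | apply: smooth_affine; exact: smooth_flat].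
have flat0 x : x <= 0 -> flat 1 x = 0 by rewrite /flat leNgt => /negbTE ->.
have flat_gt0 x : 0 < x -> 0 < flat 1 x.
  by move=> x0; rewrite /flat x0 hornerC mul1r expR_gt0.
have flat_ge0 x : 0 <= flat 1 x.
  by have [/flat0 ->//|/flat_gt0/ltW] := leP x 0.
have rho0 x : x <= 0 -> rho x = 0 by move=> x0; rewrite /rho/= flat0// mul0r.
have rho1 x : 1 <= x -> rho x = 0.
  by move=> x1; rewrite /rho/= [X in _ * X]flat0 ?mulr0//; lra.
have rho_ge0 x : 0 <= rho x by exact: mulr_ge0.
have [|F dF] := @continuous_primitive rho 1 (smooth_continuous srho).
  move=> x; rewrite ltr_normr => /orP[/ltW/rho1//|x1]; apply: rho0; lra.
have cF a b : {within `[a, b], continuous F}.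
  apply: continuous_subspaceT => x; apply: differentiable_continuous.
  by apply/derivable1_diffP; have [] := dF x.
have mvt a b : a <= b -> exists2 c, a <= c <= b & F b - F a = rho c * (b - a).
  move=> ab; have [c] := @MVT_segment _ F rho a b ab (fun x _ => dF x) (cF a b).
  by rewrite in_itv; exists c.
have F0 x : x <= 0 -> F x = F 0.
  move=> /mvt[c /andP[_ c0] /eqP]; rewrite rho0// mul0r subr_eq0 => /eqP; lra.
have F1 x : 1 <= x -> F x = F 1.
  move=> /mvt[c /andP[c0 _] /eqP]; rewrite rho1// mul0r subr_eq0 => /eqP; lra.
have Fle a b : a <= b -> F a <= F b.
  move=> ab; rewrite -subr_ge0; have [c _ ->] := mvt _ _ ab.
  by rewrite mulr_ge0// subr_ge0.
(* Strictness needs a mean value point in the open interval, where both factors of [rho] are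
   positive. *)
have F01 : F 0 < F 1.
  rewrite -subr_gt0.
  have [c c01 ->] := @MVT _ F rho 0 1 ltr01 (fun x _ => dF x) (cF 0 1).
  move: c01; rewrite in_itv/= => /andP[c0 c1].
  by rewrite subr0 mulr1 mulr_gt0// flat_gt0//; lra.
pose k := (F 1 - F 0)^-1.
have k0 : 0 < k by rewrite invr_gt0 subr_gt0.
pose S := (cst k) \* (F \+ cst (- F 0)).
have sF : smooth F.
  by move=> [//|n]; exists rho; [exact: dF | exact: srho].
have sS : smooth S.
  apply: smoothM; first by move=> n; exact: diffn_cst.
  by apply: smoothD => // n; exact: diffn_cst.
have S1 : k * (F 1 - F 0) = 1 by rewrite mulVf// subr_eq0 gt_eqF.
exists S; split => //.
- by move=> x x0; rewrite /S/= F0// subrr mulr0.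
- by move=> x x1; rewrite /S/= F1.
- move=> x; rewrite derive1E.
  have d := is_deriveZ k (is_deriveD (dF x) (is_derive_cst (- F 0) x (1 : R))).
  rewrite (_ : S = k \*: (F + cst (- F 0))); last by [].
  by have [_ ->] := d; rewrite addr0 mulr_ge0// ltW.
- move=> x; rewrite /S/=; apply/andP; split.
    rewrite mulr_ge0 ?(ltW k0)// subr_ge0.
    by have [/F0 ->//|/ltW/Fle] := leP x 0.
  rewrite -S1 ler_pM2l// lerD2r.
  by have [/F1 ->//|/ltW/Fle] := leP 1 x.
Qed.
End SmoothStep.

(** * Product test functions *)

Section TestFunctions.
Context {R : realType}.
Implicit Types (f : R -> R).

Lemma cvg_rV (T : Type) (F : set_system T) {FF : Filter F} n
    (f : T -> 'rV[R]_n) (l : 'rV[R]_n) :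
  (forall j, f x ord0 j @[x --> F] --> l ord0 j) -> f @ F --> l.
Proof.
move=> fl A [P nP PA]; apply: (filterS (fun x => @PA (f x))).
apply: filter_forall => i; apply: filter_forall => j.
rewrite (ord1 i); exact: (fl j _ (nP ord0 j)).
Qed.

Lemma cvg_derive k (phi : 'rV[R]_k -> R) (tau v : 'rV[R]_k) (d : R) :
  h^-1 * (phi (h *: v + tau) - phi tau) @[h --> 0^'] --> d ->
  derivable phi tau v /\ 'D_v phi tau = d.
Proof.
move=> fd; split; last exact: cvg_lim.
by apply/cvg_ex; exists d.
Qed.

Definition prod_rV k (f : 'I_k -> R -> R) (tau : 'rV[R]_k) : R :=
  \prod_i f i (tau ord0 i).

Lemma prod_rV_derive k (f : 'I_k -> R -> R) j : smooth (f j) ->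
  (forall tau, derivable (prod_rV f) tau (delta_mx ord0 j)) /\
  pderiv j (prod_rV f) =
    prod_rV (fun i => if i == j then derive1 (f i) else f i).
Proof.
move=> /smooth_derive[fd _].
suff H tau : derivable (prod_rV f) tau (delta_mx ord0 j) /\
    'D_(delta_mx ord0 j) (prod_rV f) tau =
    prod_rV (fun i => if i == j then derive1 (f i) else f i) tau.
  by split=> [tau|]; [have [] := H tau | apply/funext => tau; have [] := H tau].
apply: cvg_derive.
pose C := \prod_(i | i != j) f i (tau ord0 i).
have -> : prod_rV (fun i => if i == j then derive1 (f i) else f i) tau
    = derive1 (f j) (tau ord0 j) * C.
  rewrite /prod_rV (bigD1 j)//= eqxx; congr (_ * _).
  by apply: eq_bigr => i /negbTE ->.
have -> : (fun h : R => h^-1 * (prod_rV f (h *: delta_mx ord0 j + tau) - prod_rV f tau)) =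
   (fun h => h^-1 * (f j (h + tau ord0 j) - f j (tau ord0 j)) * C).
  apply/funext => h; rewrite -mulrA mulrBl /prod_rV; congr (_ * (_ - _)); last first.
    by rewrite (bigD1 j)//=.
  rewrite (bigD1 j)//= !mxE !eqxx mulr1; congr (_ * _).
  by apply: eq_bigr => i ij; rewrite !mxE (negbTE ij) andbF mulr0 add0r.
by apply: cvgM; [exact/is_derive1P | exact: cvg_cst].
Qed.

Lemma cvg_prod (T : Type) (F : set_system T) {FF : Filter F} (I : Type)
    (s : seq I) (f : I -> T -> R) (a : I -> R) :
  (forall i, f i x @[x --> F] --> a i) ->
  \prod_(i <- s) f i x @[x --> F] --> \prod_(i <- s) a i.
Proof.
move=> fa; elim: s => [|i s IH].
  have -> : (fun x => \prod_(j <- [::]) f j x) = fun=> 1.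
    by apply/funext => x; rewrite big_nil.
  by rewrite [X in _ --> X]big_nil; exact: cvg_cst.
have -> : (fun x => \prod_(j <- i :: s) f j x) =
    fun x => f i x * \prod_(j <- s) f j x.
  by apply/funext => x; rewrite big_cons.
by rewrite [X in _ --> X]big_cons; exact: cvgM.
Qed.

Lemma prod_rV_continuous k (f : 'I_k -> R -> R) :
  (forall i, continuous (f i)) -> continuous (prod_rV f).
Proof.
move=> cf tau; apply: (@cvg_prod _ (nbhs tau)) => i.
apply: (@continuous_comp _ _ _ (fun tau : 'rV[R]_k => tau ord0 i) (f i)).
  exact: coord_continuous.
exact: cf.
Qed.

Lemma prod_rV_Cn k n (f : 'I_k -> R -> R) :
  (forall i, smooth (f i)) -> Cn n (prod_rV f).
Proof.
elim: n f => [|n IH] f sf /=.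
  by split => //; apply: prod_rV_continuous => i; exact: smooth_continuous.
split; first by apply: prod_rV_continuous => i; exact: smooth_continuous.
move=> j; have [df ->] := prod_rV_derive (sf j); split => //.
apply: IH => i; case: ifP => // _.
by have [] := smooth_derive (sf i).
Qed.

Lemma prod_rV_cpt k (f : 'I_k -> R -> R) M :
  (forall i x, M < `|x| -> f i x = 0) ->
  forall tau, ~ cube M tau -> prod_rV f tau = 0.
Proof.
move=> f0 tau /existsNP[i /negP]; rewrite -ltNge => /(f0 i) fi.
by rewrite /prod_rV (bigD1 i)//= fi mul0r.
Qed.

Lemma prod_rV_test k (f : 'I_k -> R -> R) M : (forall i, smooth (f i)) ->
  (forall i x, M < `|x| -> f i x = 0) -> test_function (prod_rV f).
Proof.
move=> sf f0; split; first by move=> n; exact: prod_rV_Cn.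
by exists M; exact: prod_rV_cpt.
Qed.

Lemma foldr_pderiv_prod_rV k (f : 'I_k -> R -> R) (s : seq 'I_k) :
  (forall i, smooth (f i)) -> uniq s ->
  foldr (@pderiv R k) (prod_rV f) s =
    prod_rV (fun i => if i \in s then derive1 (f i) else f i).
Proof.
move=> sf; elim: s => [|j s IH]//= /andP[js us].
rewrite IH// (prod_rV_derive _).2; last by rewrite (negbTE js).
congr prod_rV; apply/funext => i; rewrite inE.
by case: eqP => [->|]//=; rewrite (negbTE js).
Qed.

Context {V : completeNormedModType R[i]} (ip : {dot V for Num.conj}).

Lemma foldl_distr_deriv k (u : ('rV[R]_k -> R) -> operator V) s phi :
  foldl (fun u i => distr_deriv i u) u s phi =
  iter (size s) (@oppop R V) (u (foldr (@pderiv R k) phi s)).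
Proof. by elim: s u => //= i s IH u; rewrite IH -iterSr. Qed.

Lemma iter_oppop n (A : operator V) :
  dom (iter n (@oppop R V) A) = dom A /\
  forall x, iter n (@oppop R V) A x = (-1) ^+ n *: A x.
Proof.
elim: n => [|n [dE aE]] /=; first by split => // x; rewrite scale1r.
by split => // x; rewrite aE exprS mulN1r scaleNr.
Qed.

(** Transferring the k derivatives to the test function gives the sign (-1)^k, and each of them
    falls on a different factor of the product. *)
Lemma Tstar_prod_rV k (Qt : R -> operator V) (f : R -> R) (x : V) :
  smooth f ->
  dom (Tstar ip Qt (prod_rV (fun _ : 'I_k => f))) x ->
  forall z, ip (Tstar ip Qt (prod_rV (fun _ : 'I_k => f)) x) z =
   (-1) ^+ k * cintegral_rV (fun tau : 'rV[R]_k =>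
     (prod_rV (fun=> derive1 f) tau)%:C%C * ip (TQ Qt tau x) z).
Proof.
move=> sf; rewrite /Tstar foldl_distr_deriv.
rewrite foldr_pderiv_prod_rV ?enum_uniq// size_enum_ord.
have -> : prod_rV (fun i => if i \in enum 'I_k then derive1 f else f) =
   prod_rV (fun _ : 'I_k => derive1 f).
  by congr prod_rV; apply/funext => i; rewrite mem_enum.
have [-> E] := iter_oppop k
  (regular_distribution ip (TQ Qt) (prod_rV (fun _ : 'I_k => derive1 f))).
(* Membership in the domain contains the existence of the weak integral, so the vector picked by
   [xget] satisfies its defining identity rather than being the default 0. *)
move=> [_ /xgetPex] /(_ 0) wi z.
by rewrite E linearZl_LR/= wi.
Qed.

End TestFunctions.

(** * Iterated integrals *)

Section IteratedIntegrals.
Context {R : realType}.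
Local Notation mu := (@lebesgue_measure R).

(** The new coordinate goes in front: this is literally the term in the recursion of [integral_rV],
    so that splitting off one integral holds by conversion. *)
Definition rcons0 k (x : R) (tau : 'rV[R]_k) : 'rV[R]_k.+1 :=
  row_mx (const_mx x : 'rV_1) tau.

Lemma rcons0_l k x (tau : 'rV[R]_k) i : rcons0 x tau ord0 (@lshift 1 k i) = x.
Proof. by rewrite /rcons0 (@row_mxEl _ 1 1 k) mxE. Qed.

Lemma rcons0_r k x (tau : 'rV[R]_k) i :
  rcons0 x tau ord0 (@rshift 1 k i) = tau ord0 i.
Proof. by rewrite /rcons0 (@row_mxEr _ 1 1 k). Qed.

Lemma rcons0_continuous (T : topologicalType) k (x : T -> R) (tau : T -> 'rV[R]_k) :
  continuous x -> continuous tau -> continuous (fun p => rcons0 (x p) (tau p)).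
Proof.
move=> cx ct p; apply: (@cvg_rV _ _ (nbhs p)) => j.
have [i ->|i ->] := @split_ordP 1 k j.
  have -> : (fun q => rcons0 (x q) (tau q) ord0 (@lshift 1 k i)) = x.
    by apply/funext => q; exact: rcons0_l.
  by rewrite rcons0_l; exact: cx.
have -> : (fun q => rcons0 (x q) (tau q) ord0 (@rshift 1 k i)) =
    (fun q => tau q ord0 i).
  by apply/funext => q; exact: rcons0_r.
rewrite rcons0_r.
apply: (@continuous_comp _ _ _ tau (fun tau : 'rV[R]_k => tau ord0 i)).
  exact: ct.
exact: coord_continuous.
Qed.

Lemma continuous_pair (T U W : topologicalType) (f : T -> U) (g : T -> W) :
  continuous f -> continuous g -> continuous (fun x => (f x, g x)).
Proof.
move=> cf cg x A [[B C] /= [nB nC] BC].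
rewrite nbhs_filterE; near=> y; apply: BC; split => /=; near: y.
  exact: (cf x).
exact: (cg x).
Unshelve. all: by end_near.
Qed.

Lemma continuous_compose (T U W : topologicalType) (f : T -> U) (g : U -> W) :
  continuous f -> continuous g -> continuous (fun x => g (f x)).
Proof. by move=> cf cg x; apply: continuous_comp; [exact: cf | exact: cg]. Qed.

Lemma continuous_rcons0r k (f : 'rV[R]_k.+1 -> R) (x : R) :
  continuous f -> continuous (fun tau => f (rcons0 x tau)).
Proof.
move=> cf; apply: (@continuous_compose _ _ _ (rcons0 x) f) => //.
apply: (@rcons0_continuous 'rV[R]_k k (cst x) id).
  exact: cst_continuous.
by move=> ?; exact: cvg_id.
Qed.

(** The parameter space is an arbitrary topological space, so sequential dominated convergence is
    not at hand. Instead, compactness of [-M, M] makes J(z, y) close to J(x, y) uniformly in y for z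
    near x. *)
Lemma continuous_param_integral (T : topologicalType) (J : T * R -> R) M :
  continuous J -> (forall x y, M < `|y| -> J (x, y) = 0) ->
  continuous (fun x => \int[mu]_y J (x, y))%R.
Proof.
move=> cJ J0 x.
have cJx z : continuous (fun y => J (z, y)).
  move=> y; apply: (@continuous_comp _ _ _ (pair z) J); last exact: cJ.
  apply: (@continuous_pair _ _ _ (cst z) id) => ?; [exact: cvg_cst|exact: cvg_id].
have iJ z : mu.-integrable setT (EFin \o (fun y => J (z, y))).
  by apply: (@integrable_cpt _ _ M) => // y; exact: J0.
pose K : set R := `[- M, M]%classic.
have cK : compact K by exact: segment_compact.
have mK := @measurable_itv R `[- M, M]; rewrite -/K in mK.
have KE z : (\int[mu]_y J (z, y) = \int[mu]_(y in K) J (z, y))%R.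
  rewrite [RHS]Rintegral_mkcond; apply: eq_Rintegral => y _.
  rewrite patchE /K; case: ifPn => //; rewrite notin_setE/= in_itv/= => /negP.
  by rewrite -ler_norml -ltNge; exact: J0.
have iK z : mu.-integrable K (EFin \o (fun y => J (z, y))).
  by apply: integrableS (iJ z).
have Kfin : (mu K < +oo)%E by exact: compact_finite_measure.
have -> : (fun z => \int[mu]_y J (z, y))%R = (fun z => \int[mu]_(y in K) J (z, y))%R.
  by apply/funext.
apply/cvgrPdist_le => e e0.
(* The added 1 keeps [c] positive when [K] is a null set. *)
pose c := fine (mu K) + 1.
have c0 : 0 < c by rewrite ltr_wpDl// fine_ge0.
have ec0 : 0 < e / c / 2 by rewrite !divr_gt0.
pose P z y := `|J (x, y) - J (z, y)| <= e / c.
have PK : \forall z \near x, K `<=` P z.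
  apply: (compact_near_coveringP K).1 => // y _.
  (* J(x, y') and J(z, y') are both compared with J(x, y), each at the cost of half the error. *)
  have /cvgrPdist_le/(_ _ ec0) [[A B] /= [nA nB] AB] := cJ (x, y).
  exists (B, A) => //= -[y' z] /= [By Az].
  have h1 := AB (z, y') (conj Az By).
  have h2 := AB (x, y') (conj (nbhs_singleton nA) By).
  rewrite /P -(subrK (J (x, y)) (J (x, y'))) -addrA (le_trans (ler_normD _ _))//.
  by rewrite [leRHS]splitr lerD// distrC.
apply: filterS PK => z Pz.
have iB : mu.-integrable K (EFin \o (fun y => J (x, y) - J (z, y))).
  rewrite (_ : _ \o _ = (EFin \o (fun y => J (x, y))) \-
    (EFin \o (fun y => J (z, y))))%E; last by [].
  exact: integrableB (iK x) (iK z).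
 rewrite -RintegralB//.
apply: (le_trans (@le_normr_Rintegral _ _ _ mu K _ mK iB)).
apply: (@le_trans _ _ (\int[mu]_(y in K) (e / c))%R).
  apply: (@le_Rintegral _ _ _ mu K _ _ mK) => //.
  - exact: (integrable_norm iB).
  - apply: continuous_compact_integrable => //.
    by apply: continuous_subspaceT => y; exact: cvg_cst.
by rewrite Rintegral_cst// -mulrA ger_pMr// ler_pdivrMl// mulr1 /c lerDl ler01.
Qed.

Lemma cube_rcons0 k M x (tau : 'rV[R]_k) :
  cube M (rcons0 x tau) <-> `|x| <= M /\ cube M tau.
Proof.
split=> [c|[xM c] j].
  split; first by have := c (@lshift 1 k ord0); rewrite rcons0_l.
  by move=> i; have := c (@rshift 1 k i); rewrite rcons0_r.
have [i ->|i ->] := @split_ordP 1 k j; first by rewrite rcons0_l.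
by rewrite rcons0_r.
Qed.

Lemma integral_rVS k (f : 'rV[R]_k.+1 -> R) :
  integral_rV f = (\int[mu]_x integral_rV (fun tau => f (rcons0 x tau)))%R.
Proof. by []. Qed.

Lemma integral_rV0 k : integral_rV (fun _ : 'rV[R]_k => 0) = 0.
Proof.
elim: k => // k IH; rewrite integral_rVS.
under eq_Rintegral do rewrite IH.
by rewrite Rintegral_cst// mul0r.
Qed.

Lemma eq_integral_rV k (f g : 'rV[R]_k -> R) :
  f =1 g -> integral_rV f = integral_rV g.
Proof. by move=> /funext ->. Qed.

(** The parameter space is general because the induction on k moves the outermost integration
    variable into it, replacing [T] by T x R. *)
Lemma integral_rV_continuous (T : topologicalType) k (F : T * 'rV[R]_k -> R) M :
  continuous F -> (forall x tau, ~ cube M tau -> F (x, tau) = 0) ->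
  continuous (fun x => integral_rV (fun tau => F (x, tau))).
Proof.
elim: k T F => [|k IH] T F cF F0.
  change (continuous (fun x => F (x, 0))).
  apply: (@continuous_compose _ _ _ (fun x : T => (x, 0 : 'rV[R]_0)) F); last exact: cF.
  by apply: (@continuous_pair _ _ _ id (cst (0 : 'rV[R]_0))) => ?; [exact: cvg_id|exact: cvg_cst].
pose G (p : (T * R) * 'rV[R]_k) := F (p.1.1, rcons0 p.1.2 p.2).
have cG : continuous G.
  rewrite /G; apply: (@continuous_compose ((T * R) * 'rV[R]_k)%type (T * 'rV[R]_k.+1)%type R
    (fun p : (T * R) * 'rV[R]_k => (p.1.1, rcons0 p.1.2 p.2)) F); last exact: cF.
  apply: (@continuous_pair _ _ _ (fun p => p.1.1) (fun p => rcons0 p.1.2 p.2)).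
    by apply: (@continuous_compose _ _ _ fst fst) => q; exact: cvg_fst.
  apply: rcons0_continuous; last by move=> q; exact: cvg_snd.
  by apply: (@continuous_compose _ _ _ fst snd) => q; [exact: cvg_fst | exact: cvg_snd].
apply: (@continuous_param_integral T
  (fun p => integral_rV (fun tau => G (p, tau))) M).
  apply: (IH _ G cG) => p tau ct; apply: F0; by move/cube_rcons0 => [].
move=> x y My; rewrite -[RHS](integral_rV0 k); apply: eq_integral_rV => tau.
by apply: F0; move/cube_rcons0 => [+ _]; rewrite leNgt My.
Qed.

Lemma integral_rVZl k (f : 'rV[R]_k -> R) M c : continuous f ->
  (forall tau, ~ cube M tau -> f tau = 0) ->
  integral_rV (fun tau => c * f tau) = c * integral_rV f.
Proof.
elim: k f => // k IH f cf f0; rewrite !integral_rVS.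
have cF : continuous (fun p : R * 'rV[R]_k => f (rcons0 p.1 p.2)).
  apply: (@continuous_compose _ _ _
    (fun p : R * 'rV[R]_k => rcons0 p.1 p.2) f); last exact: cf.
  by apply: rcons0_continuous => q; [exact: cvg_fst | exact: cvg_snd].
have F0 x tau : ~ cube M tau -> f (rcons0 x tau) = 0.
  by move=> ct; apply: f0; move/cube_rcons0 => [].
rewrite -RintegralZl//.
  apply: eq_Rintegral => x _; apply: IH; last exact: F0.
  exact: continuous_rcons0r.
apply: (@integrable_cpt _ _ M).
  exact: (@integral_rV_continuous R k (fun p => f (rcons0 p.1 p.2)) M cF F0).
move=> x Mx; rewrite -[RHS](integral_rV0 k); apply: eq_integral_rV => tau.
by apply: f0; move/cube_rcons0 => [+ _]; rewrite leNgt Mx.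
Qed.

Definition mass1 (kappa : R -> R) a b :=
  [/\ continuous kappa, forall x, 0 <= kappa x,
      forall x, ~ (a <= x <= b) -> kappa x = 0 &
      (\int[mu]_x kappa x)%R = 1].

Lemma integrable_mass1M kappa a b J : mass1 kappa a b -> continuous J ->
  mu.-integrable setT (EFin \o (fun x => kappa x * J x)).
Proof.
move=> [ck _ k0 _] cJ; apply: (@integrable_cpt _ _ (Num.max `|a| `|b|)).
  by move=> x; apply: cvgM; [exact: ck | exact: cJ].
move=> x; rewrite gt_max => /andP[ax bx].
rewrite k0 ?mul0r// => /andP[ax' xb].
have [x0|x0] := lerP 0 x.
  by move: bx; rewrite (ger0_norm x0) ltNge (le_trans xb)// ler_norm.
move: ax; rewrite (ltr0_norm x0) ltNge => /negP; apply.
by have := ler_norm (- a); rewrite normrN; apply: le_trans; rewrite lerN2.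
Qed.

(** Only the values of J on the support count, and there J lies between c - eta and c + eta;
    integrating these constants against a density of mass 1 returns them. *)
Lemma mass1_average kappa a b J c eta : mass1 kappa a b -> continuous J ->
  (forall x, a <= x <= b -> `|J x - c| <= eta) ->
  `|(\int[mu]_x (kappa x * J x))%R - c| <= eta.
Proof.
move=> mk cJ Jc; have [ck kge0 k0 k1] := mk.
have cc (d : R) : continuous (cst d : R -> R) by move=> x; exact: cvg_cst.
have iE d : (\int[mu]_x (kappa x * d) = d)%R.
  have := @RintegralZr _ _ _ mu setT kappa d measurableT.
  rewrite k1 mul1r => -> //.
  have := integrable_mass1M mk (cc 1).
  by rewrite (_ : (fun x => kappa x * cst 1 x) = kappa)//; apply/funext => x; rewrite mulr1.
have le (J1 J2 : R -> R) : continuous J1 -> continuous J2 ->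
   (forall x, a <= x <= b -> J1 x <= J2 x) ->
   (\int[mu]_x (kappa x * J1 x) <= \int[mu]_x (kappa x * J2 x))%R.
  move=> c1 c2 J12; apply: le_Rintegral => //.
  - exact: integrable_mass1M mk c1.
  - exact: integrable_mass1M mk c2.
  move=> x _; have [/J12|/k0 ->] := pselect (a <= x <= b); last by rewrite !mul0r.
  by apply: ler_wpM2l.
rewrite ler_distl; apply/andP; split.
  rewrite -[leLHS]iE; apply: (le (fun=> c - eta) J) => //; first exact: cc.
  by move=> x /Jc; rewrite ler_distl => /andP[].
rewrite -[leRHS]iE; apply: (le J (fun=> c + eta)) => //; first exact: cc.
by move=> x /Jc; rewrite ler_distl => /andP[].
Qed.
End IteratedIntegrals.

(** * Approximate delta functions at the corners *)

Section Corners.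
Context {R : realType}.
Local Notation mu := (@lebesgue_measure R).

(* (-1)^k times the alternating sum of g over the corners of [0, t]^k *)
Fixpoint corner (t : R) k : ('rV[R]_k -> R) -> R :=
  match k with
  | 0 => fun g => g 0
  | k'.+1 => fun g => corner t (fun tau : 'rV_k' => g (rcons0 0 tau)) -
                      corner t (fun tau : 'rV_k' => g (rcons0 t tau))
  end.

(** [tau] lies in one of the small boxes attached to the corners of [0, t]^k, on the outer side in
    every coordinate, and [sigma] is that corner. *)
Definition near_corner (eps t : R) k (tau sigma : 'rV[R]_k) := forall i,
  (- eps <= tau ord0 i <= 0 /\ sigma ord0 i = 0) \/
  (t <= tau ord0 i <= t + eps /\ sigma ord0 i = t).

Lemma near_corner_rcons0 eps t k x y (tau sigma : 'rV[R]_k) :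
  (- eps <= x <= 0 /\ y = 0) \/ (t <= x <= t + eps /\ y = t) ->
  near_corner eps t tau sigma ->
  near_corner eps t (rcons0 x tau) (rcons0 y sigma).
Proof.
move=> xy ts j; have [i ->|i ->] := @split_ordP 1 k j.
  by rewrite !rcons0_l.
by rewrite !rcons0_r.
Qed.

Lemma prod_rV_rcons0 k (f : R -> R) x (tau : 'rV[R]_k) :
  prod_rV (fun=> f) (rcons0 x tau) = f x * prod_rV (fun=> f) tau.
Proof.
rewrite /prod_rV (@big_split_ord _ _ _ 1 k)/= big_ord1 rcons0_l.
by congr (_ * _); apply: eq_bigr => i _; rewrite rcons0_r.
Qed.

Section smear.
Variables (kappa0 kappat : R -> R) (eps t : R).
Hypothesis t0 : 0 < t.
Hypotheses (m0 : mass1 kappa0 (- eps) 0) (mt : mass1 kappat t (t + eps)).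
Let kappa x := kappa0 x - kappat x.
Let M := t + eps.

Let kappa_continuous : continuous kappa.
Proof.
move=> x; have [c0 _ _ _] := m0; have [ct _ _ _] := mt.
by apply: cvgB; [exact: c0 | exact: ct].
Qed.

Let kappa_cpt (x : R) : M < `|x| -> kappa x = 0.
Proof.
have [_ _ z0 _] := m0; have [_ _ zt _] := mt.
move=> Mx; rewrite /kappa z0 ?zt ?subrr// => /andP[a b]; move: Mx; rewrite ltNge.
  by move=> /negP; apply; rewrite ger0_norm// (le_trans (ltW t0)).
by move=> /negP; apply; rewrite ler0_norm// (@le_trans _ _ eps) 1?lerNl// lerDr ltW.
Qed.

(** Each coordinate is integrated against a difference of two densities; the two averaging errors
    add, whence the factor 2 per coordinate. Keeping [g0] independent of [g] lets the induction
    freeze a coordinate at x in [g] and at the nearby 0 or t in [g0]. It also gives a uniform bound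
    on the smeared integral, by taking g0 = 0. *)
Lemma smear_corner k (g g0 : 'rV[R]_k -> R) eta : continuous g ->
  (forall tau sigma, near_corner eps t tau sigma ->
     `|g tau - g0 sigma| <= eta) ->
  `|integral_rV (fun tau => prod_rV (fun=> kappa) tau * g tau) - corner t g0|
    <= 2 ^+ k * eta.
Proof.
elim: k g g0 => [|k IH] g g0 cg gg0.
  rewrite /= /prod_rV big_ord0 mul1r expr0 mul1r; apply: gg0; case; by [].
pose F (p : R * 'rV[R]_k) := prod_rV (fun=> kappa) p.2 * g (rcons0 p.1 p.2).
have cprod : continuous (prod_rV (fun _ : 'I_k => kappa)).
  by apply: prod_rV_continuous => _; exact: kappa_continuous.
have cF : continuous F.
  move=> p; apply: cvgM.
    exact: (@continuous_compose _ _ _ snd _ (fun _ => cvg_snd) cprod).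
  apply: (@continuous_compose _ _ _ (fun p : R * 'rV[R]_k => rcons0 p.1 p.2) g) => //.
  by apply: rcons0_continuous => q; [exact: cvg_fst | exact: cvg_snd].
have F0 x tau : ~ cube M tau -> F (x, tau) = 0.
  by move=> ct; rewrite /F/= (prod_rV_cpt _ ct) ?mul0r// => _; exact: kappa_cpt.
pose J x := integral_rV (fun tau => F (x, tau)).
have cJ : continuous J by exact: integral_rV_continuous cF F0.
rewrite integral_rVS.
have -> : (fun x : R => integral_rV (fun tau =>
     prod_rV (fun=> kappa) (rcons0 x tau) * g (rcons0 x tau))) =
   (fun x => kappa0 x * J x - kappat x * J x).
  apply/funext => x; rewrite -mulrBl -/(kappa x) /J.
  rewrite -(@integral_rVZl _ _ _ M).
  - by apply: eq_integral_rV => tau; rewrite prod_rV_rcons0 mulrA.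
  - apply: (@continuous_compose _ _ _ (pair x) F) => //.
    apply: (@continuous_pair _ _ _ (cst x) id); first exact: cst_continuous.
    by move=> ?; exact: cvg_id.
  - exact: F0.
rewrite RintegralB//; [|exact: integrable_mass1M m0 cJ|exact: integrable_mass1M mt cJ].
have E (a b c d : R) : a - b - (c - d) = (a - c) - (b - d) by ring.
rewrite /= E.
have -> : 2 ^+ k.+1 * eta = 2 ^+ k * eta + 2 ^+ k * eta by rewrite exprS; ring.
rewrite (le_trans (ler_normB _ _))// lerD//.
  apply: (mass1_average m0 cJ) => x x0.
  apply: IH; first exact: continuous_rcons0r.
  by move=> tau sigma ts; apply: gg0; apply: near_corner_rcons0 => //; left.
apply: (mass1_average mt cJ) => x xt.
apply: IH; first exact: continuous_rcons0r.
by move=> tau sigma ts; apply: gg0; apply: near_corner_rcons0 => //; right.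
Qed.
End smear.

(** Off [a, a + eps] the step is locally constant, hence its derivative vanishes there; on the
    interval the derivative integrates to 1 - 0 by the fundamental theorem of calculus. *)
Lemma scaled_step (S : R -> R) (a eps : R) : 0 < eps -> smooth S ->
  (forall x, x <= 0 -> S x = 0) -> (forall x, 1 <= x -> S x = 1) ->
  (forall x, 0 <= derive1 S x) ->
  let P := fun x => S (eps^-1 * x - eps^-1 * a) in
  [/\ smooth P, forall x, x <= a -> P x = 0, forall x, a + eps <= x -> P x = 1 &
      mass1 (derive1 P) a (a + eps)].
Proof.
move=> e0 sS S0 S1 dS P.
have sP : smooth P by exact: smooth_affine.
have P0 x : x <= a -> P x = 0.
  by move=> xa; apply: S0; rewrite -mulrBr pmulr_rle0 ?invr_gt0// subr_le0.
have P1 x : a + eps <= x -> P x = 1.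
  by move=> xa; apply: S1; rewrite -mulrBr ler_pdivlMl// mulr1 lerBrDl.
have [dP sP'] := smooth_derive sP.
have z x : ~ (a <= x <= a + eps) -> derive1 P x = 0.
  move=> /negP; rewrite negb_and -!ltNge derive1E => /orP[xa|xa].
    apply: (@derive_val _ _ _ x 1 P 0).
    apply: (@near_is_derive1 _ (cst (0 : R))).
    near=> y; apply/esym/P0; near: y.
    by move: (lt_nbhsl xa); apply: filterS => y; exact: ltW.
  apply: (@derive_val _ _ _ x 1 P 0).
  apply: (@near_is_derive1 _ (cst (1 : R))).
  near=> y; apply/esym/P1; near: y; move: (lt_nbhsr xa).
  by apply: filterS => y; exact: ltW.
have nonneg x : 0 <= derive1 P x.
  rewrite derive1E (_ : 'D_1 P x = derive1 S (eps^-1 * x - eps^-1 * a) * eps^-1).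
    by rewrite mulr_ge0// invr_ge0 ltW.
  apply: derive_val.
  apply: (@is_derive1_comp _ S (fun x => eps^-1 * x - eps^-1 * a)).
    by have [+ _] := smooth_derive sS.
  have d := is_deriveB (is_deriveZ eps^-1 (is_derive_id x (1 : R)))
   (is_derive_cst (eps^-1 * a : R) x (1 : R)).
  by rewrite -[X in is_derive _ _ _ X]subr0 -[X in X - 0]mulr1.
have cP' := smooth_continuous sP'.
have ab : a < a + eps by rewrite ltrDl.
split => //; split => //.
have -> : (\int[mu]_x derive1 P x = \int[mu]_(x in `[a, a + eps]) derive1 P x)%R.
  rewrite [RHS]Rintegral_mkcond; apply: eq_Rintegral => x _.
  rewrite patchE; case: ifPn => //; rewrite notin_setE/= in_itv/=; exact: z.
have cPat x : P y @[y --> x] --> P x by exact: (smooth_continuous sP).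
rewrite /Rintegral (@continuous_FTC2 _ _ P _ _ ab)//=.
- by rewrite (P0 a)// P1// subr0.
- exact: continuous_subspaceT.
- split; first by move=> x _; have [] := dP x.
    exact: cvg_at_right_filter.
  exact: cvg_at_left_filter.
Unshelve. all: by end_near.
Qed.

(** The cut-off is a step over [-eps, 0] minus a step over [t, t + eps]. Both transitions lie
    outside [0, t], so that mass of T* on the faces of the box is counted in full. *)
Lemma smooth_step_seq (t : R) : 0 < t -> exists psi : nat -> R -> R, forall n,
  let eps := n.+1%:R^-1 in
  exists kappa0 kappat, [/\ smooth (psi n),
    forall x, 0 <= psi n x <= 1,
    forall x, 0 <= x <= t -> psi n x = 1,
    forall x, ~ (- eps <= x <= t + eps) -> psi n x = 0 &
    [/\ mass1 kappa0 (- eps) 0, mass1 kappat t (t + eps) &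
        derive1 (psi n) = fun x => kappa0 x - kappat x]].
Proof.
move=> t0; have [S [sS S0 S1 dS S01]] := @smooth_step R.
pose P n a := fun x : R => S (n.+1%:R^-1^-1 * x - n.+1%:R^-1^-1 * a).
exists (fun n => P n (- n.+1%:R^-1) \- P n t) => n eps.
have e0 : 0 < eps by rewrite invr_gt0.
have [sPl Pl0 Pl1 ml] := @scaled_step S (- eps) eps e0 sS S0 S1 dS.
have [sPr Pr0 Pr1 mr] := @scaled_step S t eps e0 sS S0 S1 dS.
rewrite addNr in Pl1 ml.
exists (derive1 (P n (- eps))), (derive1 (P n t)); split.
- move=> m; apply: diffnD; first exact: sPl.
  have -> : (fun x => - P n t x) = (cst (-1) \* P n t).
    by apply/funext => x; rewrite /= mulN1r.
  by apply: diffnM; [exact: diffn_cst | exact: sPr].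
- move=> x; rewrite /= /P -/eps; have [xt|xt] := leP x t.
    by rewrite (Pr0 _ xt) subr0; exact: S01.
  have x0 : 0 <= x by rewrite (le_trans (ltW t0))// ltW.
  have /andP[s0 s1] := S01 (eps^-1 * x - eps^-1 * t).
  by rewrite (Pl1 _ x0) subr_ge0 s1 lerBlDr lerDl.
- by move=> x /andP[x0 xt]; rewrite /= /P -/eps (Pl1 _ x0) (Pr0 _ xt) subr0.
- move=> x /negP; rewrite negb_and -!ltNge => /orP[xe|xe]; rewrite /= /P -/eps.
    rewrite (Pl0 _ (ltW xe)) (Pr0 x) ?subrr// (le_trans (ltW xe))//.
    by rewrite (le_trans _ (ltW t0))// oppr_le0 ltW.
  rewrite (Pr1 _ (ltW xe)) (Pl1 x) ?subrr//.
  by rewrite (le_trans _ (ltW xe))// addr_ge0// ltW.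
split; [exact: ml | exact: mr | apply/funext => x].
have [dPl _] := smooth_derive sPl; have [dPr _] := smooth_derive sPr.
by rewrite derive1E; apply: (@derive_val _ _ _ _ _ _ _ (is_deriveB (dPl x) (dPr x))).
Qed.

End Corners.

(** * Borel sets of R^k and approximation of the indicator of a box under the integral *)

Section RadonLimit.
Context {R : realType}.
Variable k : nat.
Implicit Types (D : set 'rV[R]_k).

Lemma open_measurable_rV D : open D -> measurable (D : set (borel_rV k)).
Proof. by move=> oD; exact: sub_sigma_algebra. Qed.

Lemma closed_measurable_rV D : closed D -> measurable (D : set (borel_rV k)).
Proof.
move=> cD; rewrite -(setCK D); apply: measurableC.
by apply: open_measurable_rV; exact: closed_openC.
Qed.

Lemma closed_forall_coord (A : set R) : closed A ->
  closed [set tau : 'rV[R]_k | forall i, A (tau ord0 i)].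
Proof.
move=> cA.
rewrite (_ : [set _ | _] = \bigcap_(i in setT) ((fun tau : 'rV[R]_k => tau ord0 i) @^-1` A)).
  apply: closed_bigI => i _.
  by apply: preimage_closed => // tau _; exact: coord_continuous.
by apply/seteqP; split => tau H i; [move=> _; exact: H | exact: H].
Qed.

Lemma measurable_cube (M : R) : measurable (cube M : set (borel_rV k)).
Proof.
have -> : cube M = [set tau : 'rV[R]_k | forall i, `[- M, M]%classic (tau ord0 i)].
  by apply/seteqP; split => tau H i; have := H i; rewrite /= in_itv/= ler_norml.
apply: closed_measurable_rV; apply: closed_forall_coord; exact: itv_closed.
Qed.

Lemma measurable_time_box (t : R) : measurable (time_box t : set (borel_rV k)).
Proof.
have -> : time_box t = [set tau : 'rV[R]_k | forall i, `[0, t]%classic (tau ord0 i)].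
  by apply/seteqP; split => tau H i; have := H i; rewrite /= in_itv.
apply: closed_measurable_rV; apply: closed_forall_coord; exact: itv_closed.
Qed.

Lemma continuous_measurable_rV (phi : 'rV[R]_k -> R) : continuous phi ->
  measurable_fun setT (phi : borel_rV k -> R).
Proof.
move=> cphi; apply: (measurability _ (RGenOpens.measurableE R)).
move=> _ [_ [a [b ->] <-]]; rewrite setTI; apply: open_measurable_rV.
by apply: open_comp => [tau _|]; [exact: cphi | exact: interval_open].
Qed.

(** Dominated convergence with majorant |g|. A Radon density is integrable only on bounded sets, so
    all integrals are restricted to a cube that contains the supports. *)
Lemma Rintegral_approx_box (nu : {measure set (borel_rV k) -> \bar R})
    (g : 'rV[R]_k -> R) M D (phi : nat -> 'rV[R]_k -> R) :
  measurable (D : set (borel_rV k)) -> D `<=` cube M ->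
  nu.-integrable (cube M) (EFin \o g) ->
  (forall n, continuous (phi n)) ->
  (forall n tau, 0 <= phi n tau <= 1) ->
  (forall n tau, ~ cube M tau -> phi n tau = 0) ->
  (forall tau, phi n tau @[n --> \oo] --> (\1_D tau : R)) ->
  (\int[nu]_tau (phi n tau * g tau))%R @[n --> \oo] -->
    (\int[nu]_(tau in D) g tau)%R.
Proof.
move=> mD DM ig cphi phi01 phi0 phiD.
have mC := measurable_cube M.
have mg : measurable_fun (cube M : set (borel_rV k)) g.
  by apply/measurable_EFinP; exact: measurable_int ig.
have mp n : measurable_fun (cube M : set (borel_rV k)) (phi n).
  by apply: measurable_funTS; exact: continuous_measurable_rV.
have ED : (\int[nu]_(tau in D) g tau =
           \int[nu]_(tau in cube M) (\1_D tau * g tau))%R.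
  rewrite -(setIidr DM) Rintegral_mkcondr; apply: eq_Rintegral => tau _.
  rewrite setIidr// patchE indicE; case: (tau \in D); by rewrite ?mul1r ?mul0r.
have En n : (\int[nu]_tau (phi n tau * g tau) =
             \int[nu]_(tau in cube M) (phi n tau * g tau))%R.
  rewrite [RHS]Rintegral_mkcond; apply: eq_Rintegral => tau _.
  by rewrite patchE; case: ifPn => // /negP; rewrite inE => /phi0 ->; rewrite mul0r.
have [|||||iD _ cv] := @dominated_convergence _ (borel_rV k) R nu (cube M) mC
  (fun n tau => (phi n tau * g tau)%:E) (fun tau => ((\1_D tau : R) * g tau)%:E)
  (fun tau => `|g tau|%:E).
- by move=> n; apply/measurable_EFinP; exact: measurable_funM.
- by apply/measurable_EFinP; apply: measurable_funM => //; exact: measurable_indic.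
- apply: aeW => tau _; apply: cvg_EFin; first by near=> n.
  by apply: cvgMl; exact: phiD.
- exact: (integrable_norm ig).
- apply: aeW => tau n _; rewrite lee_fin normrM ler_piMl//.
  by have /andP[p0 p1] := phi01 n tau; rewrite ger0_norm.
rewrite ED; have -> : (fun n => \int[nu]_tau (phi n tau * g tau))%R =
    fun n => (\int[nu]_(tau in cube M) (phi n tau * g tau))%R.
  by apply/funext.
apply: fine_cvg; rewrite fineK//; exact: integrable_fin_num.
Unshelve. all: by end_near.
Qed.

End RadonLimit.

(** * Series of complex numbers *)

Section ComplexSeries.
Context {R : realType}.

Lemma Re_le_norm (z : R[i]) (b : R) : `|z| <= b%:C%C -> `|complex.Re z| <= b.
Proof.
by move=> zb; have := le_trans (normc_ge_Re z) zb; rewrite lecR.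
Qed.

Lemma Im_le_norm (z : R[i]) (b : R) : `|z| <= b%:C%C -> `|complex.Im z| <= b.
Proof.
move=> zb; have : `|z * 'i%C| <= b%:C%C.
  by rewrite normrM [`|'i%C|](_ : _ = 1) ?mulr1// normc_def/= expr0n/= add0r expr1n sqrtr1.
by move/Re_le_norm; rewrite ReiNIm normrN.
Qed.

Lemma norm_le_ReIm (z : R[i]) :
  `|z| <= (`|complex.Re z| + `|complex.Im z|)%:C%C.
Proof.
rewrite {1}[z]complexE (le_trans (ler_normD _ _))// rmorphD/= lerD//.
  by rewrite normc_def/= expr0n/= addr0 sqrtr_sqr.
rewrite normrM [`|'i%C|](_ : _ = 1) ?mul1r//.
  by rewrite normc_def/= expr0n/= addr0 sqrtr_sqr.
by rewrite normc_def/= expr0n/= add0r expr1n sqrtr1.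
Qed.

Lemma cplx_cvgP (T : Type) (F : set_system T) (FF : Filter F)
    (f : T -> Cplx R) (a : Cplx R) :
  f @ F --> a <-> (complex.Re (f x) @[x --> F] --> complex.Re a /\
                   complex.Im (f x) @[x --> F] --> complex.Im a).
Proof.
split=> [fa|[fR fI]].
  split; apply/cvgrPdist_le => e e0;
    have /cvgrPdist_le/(_ e%:C%C) := fa; rewrite ltcR => /(_ e0);
    apply: filterS => x.
    by move/Re_le_norm; case: (a) (f x) => [? ?] [? ?].
  by move/Im_le_norm; case: (a) (f x) => [? ?] [? ?].
apply/cvgrPdist_le => e e0.
(* A positive element of [R[i]] is real; it is halved between the real and the imaginary part. *)
have [e' e'0 ->] : exists2 e' : R, 0 < e' & e = (e' + e')%:C%C.
  case: e e0 => [x y]; rewrite ltcE/= => /andP[/eqP -> x0].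
  by exists (x / 2); [rewrite divr_gt0 | rewrite -splitr].
near=> x; apply: (le_trans (norm_le_ReIm _)); rewrite lecR lerD//.
  have -> : complex.Re (a - f x) = complex.Re a - complex.Re (f x).
    by case: (a) (f x) => [? ?] [? ?].
  by near: x; move/cvgrPdist_le: fR; apply.
have -> : complex.Im (a - f x) = complex.Im a - complex.Im (f x).
  by case: (a) (f x) => [? ?] [? ?].
by near: x; move/cvgrPdist_le: fI; apply.
Unshelve. all: by end_near.
Qed.

Lemma Re_series (f : nat -> Cplx R) n :
  complex.Re (series f n) = series (fun n => complex.Re (f n)) n.
Proof.
by rewrite /series/=; apply: (big_morph (fun z : Cplx R => complex.Re z)) => // -[? ?] [? ?].
Qed.

Lemma Im_series (f : nat -> Cplx R) n :
  complex.Im (series f n) = series (fun n => complex.Im (f n)) n.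
Proof.
by rewrite /series/=; apply: (big_morph (fun z : Cplx R => complex.Im z)) => // -[? ?] [? ?].
Qed.

Lemma dominated_series_cvg (u b : nat -> R) :
  (forall n, `|u n| <= b n) -> cvgn (series b) -> cvgn (series u).
Proof.
move=> ub cb; apply: normed_cvg; apply: (series_le_cvg _ _ _ cb) => n //=.
by rewrite (le_trans _ (ub n)).
Qed.

Lemma cplx_series_cvg (f : nat -> Cplx R) (b : nat -> R) :
  (forall n, `|f n| <= (b n)%:C%C) -> cvgn (series b) ->
  series f @ \oo --> ((limn (series (fun n => complex.Re (f n))) +i*
                       limn (series (fun n => complex.Im (f n))))%C : Cplx R).
Proof.
move=> fb cb; apply/cplx_cvgP; split => /=.
  under eq_fun do rewrite Re_series.
  by apply: dominated_series_cvg cb => n; exact: Re_le_norm.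
under eq_fun do rewrite Im_series.
by apply: dominated_series_cvg cb => n; exact: Im_le_norm.
Qed.

Lemma series_tail (u b : nat -> R) N :
  (forall n, `|u n| <= b n) -> cvgn (series b) ->
  `|limn (series u) - series u N| <= limn (series b) - series b N.
Proof.
move=> ub cb; have cu := dominated_series_cvg ub cb.
have b0 n : 0 <= b n by exact: le_trans (ub n).
have le m : (N <= m)%N -> `|series u m - series u N| <= limn (series b) - series b N.
  move=> Nm; apply: (@le_trans _ _ (series b m - series b N)).
    rewrite !sub_series_geq// (le_trans (ler_norm_sum _ _ _))//.
    by apply: ler_sum => i _.
  rewrite lerD2r; apply: nondecreasing_cvgn_le => //.
  by apply: nondecreasing_series.
have cv : `|series u m - series u N| @[m --> \oo] --> `|limn (series u) - series u N|.
  by apply: cvg_norm; apply: cvgB; [exact: cu | exact: cvg_cst].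
rewrite -(cvg_lim _ cv)//; apply: limr_le; first by apply/cvg_ex; eexists; exact: cv.
by near=> m; apply: le; near: m; exact: nbhs_infty_ge.
Unshelve. all: by end_near.
Qed.

(** Dominated convergence for series. The majorant makes both tails beyond some N at most e/3, and
    the finitely many remaining terms converge. It exchanges the limit of the cut-offs with the sum
    over the vectors of the state. *)
Lemma tannery (a : nat -> nat -> R) (l b : nat -> R) :
  (forall p n, `|a p n| <= b n) -> cvgn (series b) ->
  (forall n, a p n @[p --> \oo] --> l n) ->
  limn (series (a p)) @[p --> \oo] --> limn (series l).
Proof.
move=> ab cb al.
have lb n : `|l n| <= b n.
  have cv : `|a p n| @[p --> \oo] --> `|l n| by apply: cvg_norm.
  rewrite -(cvg_lim _ cv)//; apply: limr_le; first by apply/cvg_ex; eexists; exact: cv.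
  by near=> p; exact: ab.
apply/cvgrPdist_le => e e0.
have e3 : 0 < e / 3 by rewrite divr_gt0.
have /cvgrPdist_le/(_ _ e3)[N _ HN] : series b @ \oo --> limn (series b) by exact: cb.
have tN : limn (series b) - series b N <= e / 3.
  by rewrite (le_trans (ler_norm _))//; apply: HN => /=.
have cN : series (a p) N @[p --> \oo] --> series l N.
  rewrite /series/=; elim: {HN tN} N => [|N IH].
    rewrite big_geq//; under eq_fun do rewrite big_geq//; exact: cvg_cst.
  rewrite big_nat_recr//=; under eq_fun do rewrite big_nat_recr//=.
  by apply: cvgD.
near=> p.
have h1 := series_tail N lb cb.
have h2 := series_tail N (ab p) cb.
have h3 : `|series l N - series (a p) N| <= e / 3.
  by near: p; move/cvgrPdist_le: cN; apply.
move: h1 h2 h3; rewrite !ler_norml => /andP[? ?] /andP[? ?] /andP[? ?].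
by apply/andP; split; lra.
Unshelve. all: by end_near.
Qed.
End ComplexSeries.

(** * The integral of T* over the box *)

Section DistributionSide.
Context {R : realType} {V : completeNormedModType R[i]}.
Context (ip : {dot V for Num.conj}).

Lemma continuous_Re (T : topologicalType) (f : T -> Cplx R) :
  continuous f -> continuous (fun x => complex.Re (f x)).
Proof. by move=> cf x; have /cplx_cvgP[] := cf x. Qed.

Lemma continuous_Im (T : topologicalType) (f : T -> Cplx R) :
  continuous f -> continuous (fun x => complex.Im (f x)).
Proof. by move=> cf x; have /cplx_cvgP[] := cf x. Qed.

(** There are finitely many corners, so continuity of g at each of them gives one eps that serves
    for all. The tolerance e / 2^k offsets the factor 2^k of [smear_corner]. *)
Lemma smear_seq_cvg k (t : R) (kappa : nat -> R -> R) (g : 'rV[R]_k -> R) : 0 < t ->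
  (forall n, exists kappa0 kappat, [/\ mass1 kappa0 (- n.+1%:R^-1) 0,
     mass1 kappat t (t + n.+1%:R^-1) & kappa n = fun x => kappa0 x - kappat x]) ->
  continuous g ->
  integral_rV (fun tau => prod_rV (fun=> kappa n) tau * g tau) @[n --> \oo] -->
    corner t g.
Proof.
move=> t0 hk cg; apply/cvgrPdist_le => e e0.
have e2 : 0 < e / 2 ^+ k by rewrite divr_gt0// exprn_gt0.
(* Corners are indexed by boolean functions on 'I_k; as a finite type, these allow the conditions
   near each corner to be imposed simultaneously. *)
pose cor (c : 'I_k -> bool) : 'rV[R]_k := \row_i (if c i then t else 0).
have H (c : {ffun 'I_k -> bool}) : \forall n \near \oo, forall tau : 'rV[R]_k,
    (forall i, `|tau ord0 i - cor c ord0 i| <= n.+1%:R^-1) ->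
    `|g tau - g (cor c)| <= e / 2 ^+ k.
  have /cvgrPdist_le/(_ _ e2)/nbhs_ballP[d /= d0 Hd] := cg (cor c).
  have : \forall n \near \oo, n.+1%:R^-1 < d by exact: near_infty_natSinv_lt (PosNum d0).
  apply: filterS => n nd tau ct; rewrite distrC; apply: Hd; split => // i j.
  by rewrite (ord1 i) /ball/= distrC (le_lt_trans (ct j)).
have H' : \forall n \near \oo, forall (c : {ffun 'I_k -> bool}) (tau : 'rV[R]_k),
    (forall i, `|tau ord0 i - cor c ord0 i| <= n.+1%:R^-1) ->
    `|g tau - g (cor c)| <= e / 2 ^+ k.
  exact: filter_forall.
apply: filterS H' => n Hn; have [k0 [kt [m0 mt ->]]] := hk n.
have -> : e = 2 ^+ k * (e / 2 ^+ k) by rewrite mulrC divfK// expf_neq0.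
have n0 : 0 < n.+1%:R^-1 :> R by rewrite invr_gt0.
rewrite distrC; apply: (smear_corner t0 m0 mt cg) => tau sigma ts.
pose c : {ffun 'I_k -> bool} := [ffun i => sigma ord0 i == t].
have -> : sigma = cor c.
  apply/rowP => i; rewrite !mxE ffunE; case: eqP => // st.
  by have [[_ ->]|[_]] := ts i.
apply: Hn => i; rewrite !mxE ffunE.
have [[/andP[a b] ->]|[/andP[a b] ->]] := ts i.
  by rewrite (lt_eqF t0) subr0 ler0_norm// lerNl.
by rewrite eqxx ger0_norm ?subr_ge0// lerBlDl.
Qed.

(** Comparison with the zero function, whose corner sum is 0. The bound is the same for all eps <=
    1, which is what a majorant in [tannery] requires. *)
Lemma smear_bound k (t eps : R) (kappa0 kappat : R -> R) (g : 'rV[R]_k -> R) (b : R) : 0 < t -> eps <= 1 ->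
  mass1 kappa0 (- eps) 0 -> mass1 kappat t (t + eps) ->
  continuous g -> (forall tau, cube (t + 1) tau -> `|g tau| <= b) ->
  `|integral_rV (fun tau => prod_rV (fun=> (fun x => kappa0 x - kappat x)) tau * g tau)|
    <= 2 ^+ k * b.
Proof.
move=> t0 n1 m0 mt cg gb.
have corner0 : corner t (fun _ : 'rV[R]_k => 0) = 0.
  by elim: (k) => //= j ->; rewrite subrr.
rewrite -[X in `|X|]subr0 -[X in _ - X]corner0.
apply: (smear_corner t0 m0 mt cg) => tau sigma ts; rewrite subr0; apply: gb => i.
by have [[/andP[a c] _]|[/andP[a c] _]] := ts i; rewrite ler_norml; apply/andP; split; lra.
Qed.

(** The expectation of T* smeared with the p-th cut-off is computed twice, and both expressions
    converge as p grows: against the measure by dominated convergence, and as a series over the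
    state by [tannery]. The cube of size t + 1 contains the supports of all cut-offs, so the
    majorant [b] on it serves for every p. Real and imaginary parts are treated apart because the
    integrals are real. *)
Lemma radon_corner (Qt : R -> operator V) (v : nat -> V) (t : R) k
    (nu : {measure set (borel_rV k) -> \bar R}) (h : 'rV[R]_k -> R[i]) :
  TQ_well_defined ip v Qt -> Tstar_well_defined ip v Qt -> 0 < t ->
  distribution_is_measure (fun phi => expect ip v (Tstar ip Qt phi)) nu h ->
  cintegral nu (time_box t) h =
   ((limn (series (fun n => (-1) ^+ k * corner t (fun tau : 'rV[R]_k =>
        complex.Re (ip (TQ Qt tau (v n)) (v n))))) +i*
     limn (series (fun n => (-1) ^+ k * corner t (fun tau : 'rV[R]_k =>
        complex.Im (ip (TQ Qt tau (v n)) (v n))))))%C : R[i]).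
Proof.
move=> TQw Tsw t0 [rd uE].
have [_ cg bnd] := TQw k.
have [b cb gb] := bnd (t + 1).
have [psi psiP] := smooth_step_seq t0.
pose phi n := prod_rV (fun _ : 'I_k => psi n).
pose gR n (tau : 'rV[R]_k) := complex.Re (ip (TQ Qt tau (v n)) (v n)).
pose gI n (tau : 'rV[R]_k) := complex.Im (ip (TQ Qt tau (v n)) (v n)).
have cgR n : continuous (gR n) by exact: (continuous_Re (cg n (v n))).
have cgI n : continuous (gI n) by exact: (continuous_Im (cg n (v n))).
have gRb n tau : cube (t + 1) tau -> `|gR n tau| <= b n.
  by move=> /gb-/(_ n)/Re_le_norm.
have gIb n tau : cube (t + 1) tau -> `|gI n tau| <= b n.
  by move=> /gb-/(_ n)/Im_le_norm.
have spsi p : smooth (psi p) by have [? [? []]] := psiP p.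
have le1 p : p.+1%:R^-1 <= 1 :> R by rewrite invf_le1// ler1n.
have psi0 p (x : R) : t + 1 < `|x| -> psi p x = 0.
  have [? [? [_ _ _ z _]]] := psiP p; move=> xt; apply: z => /andP[a c].
  move: (le1 p) a c; set eps := p.+1%:R^-1 => p1 a c.
  by move: xt; rewrite ltNge => /negP; apply; rewrite ler_norml; apply/andP; split; lra.
have tphi p : test_function (phi p).
  by apply: (@prod_rV_test _ _ _ (t + 1)) => i; [exact: spsi | exact: psi0].
pose aR p n := (-1) ^+ k * integral_rV (fun tau : 'rV[R]_k =>
   prod_rV (fun=> derive1 (psi p)) tau * gR n tau).
pose aI p n := (-1) ^+ k * integral_rV (fun tau : 'rV[R]_k =>
   prod_rV (fun=> derive1 (psi p)) tau * gI n tau).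
have ipE p n : ip (Tstar ip Qt (phi p) (v n)) (v n) = (aR p n +i* aI p n)%C.
  rewrite Tstar_prod_rV; [| exact: spsi | exact: (Tsw _ _ (tphi p))].
  rewrite /cintegral_rV /aR /aI.
  have -> : (-1) ^+ k = ((-1) ^+ k)%:C%C :> R[i] by rewrite rmorphXn rmorphN rmorph1.
  have E1 tau : complex.Re ((prod_rV (fun=> derive1 (psi p)) tau)%:C%C *
      ip (TQ Qt tau (v n)) (v n)) = prod_rV (fun=> derive1 (psi p)) tau * gR n tau.
    by rewrite /gR; case: (ip _ _) => x y /=; rewrite mul0r subr0.
  have E2 tau : complex.Im ((prod_rV (fun=> derive1 (psi p)) tau)%:C%C *
      ip (TQ Qt tau (v n)) (v n)) = prod_rV (fun=> derive1 (psi p)) tau * gI n tau.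
    by rewrite /gI; case: (ip _ _) => x y /=; rewrite mul0r addr0.
  rewrite (eq_integral_rV E1) (eq_integral_rV E2).
  by rewrite /GRing.mul/= !mul0r subr0 addr0.
(* A majorant independent of p, summable over the vectors of the state. *)
pose B n := 2 ^+ k * b n.
have cB : cvgn (series B) by exact: is_cvg_seriesZ.
have aRB p n : `|aR p n| <= B n.
  rewrite normrM normrX normrN1 expr1n mul1r.
  have [k0 [kt [_ _ _ _ [m0 mt ->]]]] := psiP p.
  apply: (smear_bound t0 (le1 p) m0 mt (cgR n)) => tau; exact: gRb.
have aIB p n : `|aI p n| <= B n.
  rewrite normrM normrX normrN1 expr1n mul1r.
  have [k0 [kt [_ _ _ _ [m0 mt ->]]]] := psiP p.
  apply: (smear_bound t0 (le1 p) m0 mt (cgI n)) => tau; exact: gIb.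
have hk n : exists kappa0 kappat, [/\ mass1 kappa0 (- n.+1%:R^-1) 0,
     mass1 kappat t (t + n.+1%:R^-1) & derive1 (psi n) = fun x => kappa0 x - kappat x].
  by have [k0 [kt [_ _ _ _ [m0 mt E]]]] := psiP n; exists k0, kt.
have limR : limn (series (aR p)) @[p --> \oo] -->
    limn (series (fun n => (-1) ^+ k * corner t (gR n))).
  apply: (tannery aRB cB) => n; apply: cvgMr.
  exact: (smear_seq_cvg t0 hk).
have limI : limn (series (aI p)) @[p --> \oo] -->
    limn (series (fun n => (-1) ^+ k * corner t (gI n))).
  apply: (tannery aIB cB) => n; apply: cvgMr.
  exact: (smear_seq_cvg t0 hk).
have uphi p : (limn (series (aR p)) +i* limn (series (aI p)))%C =
   cintegral nu setT (fun tau => (phi p tau)%:C%C * h tau).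
  rewrite -uE// /expect.
  have -> : (fun n => ip (Tstar ip Qt (phi p) (v n)) (v n) : Cplx R) =
     (fun n => (aR p n +i* aI p n)%C : Cplx R) by apply/funext => n; exact: ipE.
  apply: esym; apply: (@cvg_lim (Cplx R)); first exact: norm_hausdorff.
  apply: (@cplx_series_cvg _ _ (B \+ B)); last first.
    by rewrite seriesD; exact: is_cvgD.
  move=> n; apply: (le_trans (norm_le_ReIm _)); rewrite lecR /=.
  by apply: lerD; [exact: aRB | exact: aIB].
have phi01 p tau : 0 <= phi p tau <= 1.
  have [? [? [_ p01 _ _ _]]] := psiP p.
  rewrite /phi /prod_rV; apply/andP; split.
    by apply: prodr_ge0 => i _; have /andP[] := p01 (tau ord0 i).
  by apply: prodr_ile1 => i _; exact: p01.
have phi0 p tau : ~ cube (t + 1) tau -> phi p tau = 0.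
  by apply: prod_rV_cpt => _; exact: psi0.
have DM : (time_box t : set 'rV[R]_k) `<=` cube (t + 1).
  move=> tau bt i; have /andP[a c] := bt i.
  by rewrite ger0_norm// (le_trans c)// lerDl.
have phiD tau : phi p tau @[p --> \oo] --> (\1_(time_box t) tau : R).
  have [bt|nbt] := pselect (time_box t tau).
    rewrite indicE mem_set//=.
    have -> : (fun p => phi p tau) = cst 1; last exact: cvg_cst.
    apply/funext => p; rewrite /phi /prod_rV big1//= => i _.
    by have [? [? [_ _ p1 _ _]]] := psiP p; exact: p1.
  rewrite indicE memNset//=.
  (* Off the closed box some coordinate has a positive distance [d] to [0, t], and the cut-off
     vanishes there as soon as 1/(p+1) < d. *)
  apply: cvg_near_cst.
  move: (nbt) => /existsNP[i /negP ti].
  have [d d0 Hd] : exists2 d : R, 0 < d & forall p : nat, p.+1%:R^-1 < d ->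
      ~ (- p.+1%:R^-1 <= tau ord0 i <= t + p.+1%:R^-1).
    move: ti; rewrite negb_and -!ltNge => /orP[ti|ti].
      by exists (- tau ord0 i); [rewrite oppr_gt0|
        move=> p + /andP[a _]; rewrite ltNge lerNl a].
    by exists (tau ord0 i - t); [rewrite subr_gt0|
        move=> p + /andP[_ a]; rewrite ltNge lerBlDl a].
  near=> p.
  have z : ~ (- p.+1%:R^-1 <= tau ord0 i <= t + p.+1%:R^-1).
    by apply: Hd; near: p; exact: near_infty_natSinv_lt (PosNum d0).
  rewrite /phi /prod_rV (bigD1 i)//=.
  by have [? [? [_ _ _ p0 _]]] := psiP p; rewrite p0// mul0r.
have cphi p : continuous (phi p).
  by apply: prod_rV_continuous => i; exact: smooth_continuous.
have [iR iI] := rd (t + 1).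
have R1 := Rintegral_approx_box (measurable_time_box t) DM iR cphi phi01 phi0 phiD.
have I1 := Rintegral_approx_box (measurable_time_box t) DM iI cphi phi01 phi0 phiD.
have uR p : limn (series (aR p)) = (\int[nu]_tau (phi p tau * complex.Re (h tau)))%R.
  have /(congr1 (@complex.Re R))/= -> := uphi p.
  by apply: eq_Rintegral => tau _; case: (h tau) => x y /=; rewrite mul0r subr0.
have uI p : limn (series (aI p)) = (\int[nu]_tau (phi p tau * complex.Im (h tau)))%R.
  have /(congr1 (@complex.Im R))/= -> := uphi p.
  by apply: eq_Rintegral => tau _; case: (h tau) => x y /=; rewrite mul0r addr0.
rewrite /cintegral; congr (_ +i* _)%C.
  have R2 : (fun p => limn (series (aR p))) =
      (fun p => \int[nu]_tau (phi p tau * complex.Re (h tau)))%R.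
    by apply/funext => p; rewrite uR.
  rewrite R2 in limR; exact: (cvg_unique _ R1 limR).
have I2 : (fun p => limn (series (aI p))) =
    (fun p => \int[nu]_tau (phi p tau * complex.Im (h tau)))%R.
  by apply/funext => p; rewrite uI.
rewrite I2 in limI; exact: (cvg_unique _ I1 limI).
Unshelve. all: by end_near.
Qed.
End DistributionSide.

(** * Taylor expansion of unitary groups *)

Section InnerProduct.
Context {R : realType} {V : completeNormedModType R[i]}.
Context (ip : {dot V for Num.conj}).
Hypothesis hip : hilbert ip.
Implicit Types (x y z : V) (A : operator V) (U : R -> V -> V).

(** The square of <y,y> x - <x,y> y is nonnegative; expanding it and dividing by <y,y> gives the
    claim. *)
Lemma ip_CauchySchwarz x y : `|ip x y| <= `|x| * `|y|.
Proof.
have [->|y0] := eqVneq y 0; first by rewrite linear0r !normr0 mulr0.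
rewrite -(@ler_pXn2r _ 2) ?nnegrE ?mulr_ge0//.
have yy0 : 0 < ip y y by rewrite hip exprn_gt0// normr_gt0.
have := dnorm_ge0 ip (ip y y *: x - ip x y *: y).
rewrite dnormB !dnormZ /= linearZl_LR linearZr_LR/= -normCKC.
rewrite [in X in _ + X](@conj_Creal _ (_ * _)); last first.
  by apply: ger0_real; apply: mulr_ge0; [exact: ltW | exact: exprn_ge0].
rewrite (ger0_norm (ltW yy0)).
have -> : forall a b c : R[i], a ^+ 2 * b + c * a - (a * c + a * c) = a * (a * b - c).
  by move=> a b c; ring.
rewrite pmulr_rge0// subr_ge0 => /le_trans; apply.
by rewrite !hip exprMn mulrC.
Qed.

(** The norm of [V] has values in [R[i]]; this is the same number as an element of [R], where real
    calculus applies. *)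
Definition nrm x : R := complex.Re `|x|.

Lemma nrmE x : `|x| = (nrm x)%:C%C.
Proof. by rewrite /nrm RRe_real// normr_real. Qed.

Lemma nrm_ge0 x : 0 <= nrm x.
Proof. by rewrite -lecR -nrmE normr_ge0. Qed.

Lemma Re_ip_le x y : `|complex.Re (ip x y)| <= nrm x * nrm y.
Proof. by apply: Re_le_norm; rewrite rmorphM/= -!nrmE ip_CauchySchwarz. Qed.

Lemma Re_realM (c : R) (z : R[i]) : complex.Re (c%:C%C * z) = c * complex.Re z.
Proof. by case: z => a b /=; rewrite mul0r subr0. Qed.

Lemma Re_B (a b : R[i]) : complex.Re (a - b) = complex.Re a - complex.Re b.
Proof. by case: a b => [? ?] [? ?]. Qed.

Lemma Re_sum I (s : seq I) (F : I -> R[i]) :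
  complex.Re (\sum_(i <- s) F i) = \sum_(i <- s) complex.Re (F i).
Proof. by apply: (big_morph (fun z : R[i] => complex.Re z)) => // -[? ?] [? ?]. Qed.

Lemma cvg_Re_ip (T : Type) (F : set_system T) (FF : Filter F) (f : T -> V) l w :
  f @ F --> l -> complex.Re (ip (f x) w) @[x --> F] --> complex.Re (ip l w).
Proof.
move=> fl; apply/cvgrPdist_le => e e0.
have w0 : 0 < nrm w + 1 by rewrite ltr_wpDl// nrm_ge0.
have ew0 : 0 < (e / (nrm w + 1))%:C%C :> R[i] by rewrite ltcR divr_gt0.
move/cvgrPdist_le: fl => /(_ _ ew0); apply: filterS => x.
rewrite nrmE lecR => lx.
rewrite -Re_B -linearBl/= (le_trans (Re_ip_le _ _))//.
rewrite (le_trans (ler_wpM2r (nrm_ge0 _) lx))// -mulrA ger_pMr//.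
by rewrite ler_pdivrMl// mulr1 lerDl ler01.
Qed.

Section Group.
Variables (A : operator V) (U : R -> V -> V).
Hypothesis AU : is_expi ip A U.

Lemma expi_lin s a x y : U s (a *: x + y) = a *: U s x + U s y.
Proof. by have [[lin _ _ _ _] _] := AU; exact: lin. Qed.

Lemma expi_0 x : U 0 x = x.
Proof. by have [[_ _ U0 _ _] _] := AU. Qed.

Lemma expi_D s r x : U (s + r) x = U s (U r x).
Proof. by have [[_ _ _ UD _] _] := AU. Qed.

Lemma expi_NK s x : U (- s) (U s x) = x.
Proof. by rewrite -expi_D addNr expi_0. Qed.

Lemma expi_KN s x : U s (U (- s) x) = x.
Proof. by rewrite -expi_D addrN expi_0. Qed.

Lemma ip_expi s x y : ip (U s x) y = ip x (U (- s) y).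
Proof.
have [[_ iso _ _ _] _] := AU.
by rewrite -{1}(expi_KN s y) iso.
Qed.

Lemma nrm_expi s x : nrm (U s x) = nrm x.
Proof.
have [[_ iso _ _ _] _] := AU; have := iso s x x; rewrite !hip => /eqP.
by rewrite eqrXn2// => /eqP; rewrite /nrm => ->.
Qed.

Lemma expi_raddf0 s : U s 0 = 0.
Proof.
apply/eqP; rewrite -normr_eq0 nrmE nrm_expi -nrmE normr0; exact: eqxx.
Qed.

Lemma expi_B s x y : U s (x - y) = U s x - U s y.
Proof.
by rewrite -[x - y]addrC -scaleN1r expi_lin scaleN1r addrC.
Qed.

Lemma expi_Z s a x : U s (a *: x) = a *: U s x.
Proof. by rewrite -[a *: x]addr0 expi_lin expi_raddf0 !addr0. Qed.

(** The group law and unitarity carry the difference quotient at s to one at 0 tested against U(-s)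
    z, where the generator gives its limit. Testing against z reduces calculus in V to real
    functions of one variable. *)
Lemma is_derive_expi x z (s : R) : dom A x ->
  is_derive s (1 : R) (fun s => complex.Re (ip (U s x) z))
    (complex.Re ('i%C * ip (U s (A x)) z)).
Proof.
move=> dx; have [_ gen] := AU; have [/(_ (conj dx erefl)) lim _] := gen x (A x).
apply/is_derive1P.
have -> : (fun h => h^-1 * (complex.Re (ip (U (h + s) x) z) - complex.Re (ip (U s x) z)))
   = (fun h => complex.Re (ip ((h^-1)%:C%C *: (U h x - x)) (U (- s) z))).
  apply/funext => h; rewrite linearZl_LR/= Re_realM linearBl/= Re_B.
  by rewrite -!ip_expi -expi_D [s + h]addrC.
have -> : 'i%C * ip (U s (A x)) z = ip ('i%C *: A x) (U (- s) z).
  by rewrite linearZl_LR/= ip_expi.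
exact: cvg_Re_ip lim.
Qed.

Definition expi_taylor k (s : R) x : V :=
  \sum_(j < k) (('i%C * s%:C%C) ^+ j / j`!%:R) *: iter j A x.

Lemma Re_ip_taylor k s x z : complex.Re (ip (expi_taylor k s x) z) =
  \sum_(j < k) s ^+ j * (complex.Re ('i%C ^+ j * ip (iter j A x) z) / j`!%:R).
Proof.
rewrite /expi_taylor linear_sumlz/= Re_sum; apply: eq_bigr => j _.
rewrite linearZl_LR/= exprMn.
have -> : 'i%C ^+ j * s%:C%C ^+ j / j`!%:R * ip (iter j A x) z =
   (s ^+ j / j`!%:R)%:C%C * ('i%C ^+ j * ip (iter j A x) z).
  rewrite rmorphM rmorphXn fmorphV rmorph_nat/=; ring.
by rewrite Re_realM; ring.
Qed.

(** The formula has the same shape as for the group itself. Hence the remainder of order k+1 at x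
    differentiates to i times the remainder of order k at A x. *)
Lemma is_derive_taylor k x z (s : R) :
  is_derive s (1 : R) (fun s => complex.Re (ip (expi_taylor k.+1 s x) z))
    (complex.Re ('i%C * ip (expi_taylor k s (A x)) z)).
Proof.
have -> : (fun s => complex.Re (ip (expi_taylor k.+1 s x) z)) =
   \sum_(j < k.+1) ((fun s : R => s ^+ j) \* cst
      (complex.Re ('i%C ^+ j * ip (iter j A x) z) / j`!%:R)).
  by apply/funext => r; rewrite Re_ip_taylor fct_sumE.
have -> : complex.Re ('i%C * ip (expi_taylor k s (A x)) z) =
  \sum_(j < k.+1) (j%:R * s ^+ j.-1 *
      (complex.Re ('i%C ^+ j * ip (iter j A x) z) / j`!%:R)).
  rewrite big_ord_recl/= !mul0r add0r.
  rewrite -[_ * ip _ _]linearZl_LR/= /expi_taylor scaler_sumr linear_sumlz Re_sum.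
  apply: eq_bigr => j _; rewrite linearZl_LR linearZl_LR -iterSr exprMn.
  rewrite /= /bump/= add0n factS natrM exprS.
  have -> : 'i%C * ('i%C ^+ j * s%:C%C ^+ j / j`!%:R * ip (A (iter j A x)) z) =
    (s ^+ j / j`!%:R)%:C%C * ('i%C * 'i%C ^+ j * ip (A (iter j A x)) z).
    by rewrite rmorphM rmorphXn fmorphV rmorph_nat/=; ring.
  rewrite Re_realM /GRing.scale/=; field.
  by rewrite nat1r !pnatr_eq0 -lt0n fact_gt0.
apply: is_derive_sum => j.
have d : is_derive s (1 : R) (fun s : R => s ^+ j) (j%:R * s ^+ j.-1).
  apply: DeriveDef; first exact: exprn_derivable.
  by rewrite exp_derive /GRing.scale/= mulr1.
have d2 := is_deriveM d (is_derive_cst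
  (complex.Re ('i%C ^+ j * ip (iter j A x) z) / j`!%:R : R) s (1 : R)).
by apply: (is_derive_eq d2); rewrite /GRing.scale/= mulr0 add0r mulrC.
Qed.

(** Induction on k through the mean value theorem, which needs a scalar function: the remainder at
    time u is paired with the remainder r at the final time s. At u = s the pairing is |r|^2, while
    its derivative is at most |r| times the bound for A x, and one factor |r| cancels. The factor
    1/k! is given up. *)
Lemma expi_taylor_le k s x : (forall j, (j < k)%N -> dom A (iter j A x)) ->
  nrm (U s x - expi_taylor k s x) <= `|s| ^+ k * nrm (iter k A x).
Proof.
elim: k s x => [|k IH] s x dk.
  by rewrite /expi_taylor big_ord0 subr0 expr0 mul1r nrm_expi.
set r := U s x - expi_taylor k.+1 s x.
pose f u := complex.Re (ip (U u x - expi_taylor k.+1 u x) r).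
pose df u := complex.Re ('i%C * ip (U u (A x) - expi_taylor k u (A x)) r).
have fd (u : R) : is_derive u (1 : R) f (df u).
  have -> : f = (fun u => complex.Re (ip (U u x) r)) -
                (fun u => complex.Re (ip (expi_taylor k.+1 u x) r)).
    by apply/funext => w; rewrite /f linearBl/= Re_B.
  rewrite /df linearBl/= mulrBr Re_B; apply: is_deriveB.
    by apply: is_derive_expi; exact: (dk 0%N).
  exact: is_derive_taylor.
have dfb u : `|u| <= `|s| -> `|df u| <= `|s| ^+ k * nrm (iter k.+1 A x) * nrm r.
  move=> us; rewrite /df -[_ * ip _ _]linearZl_LR.
  rewrite (le_trans (Re_ip_le _ _))// ler_wpM2r ?nrm_ge0//.
  have -> : nrm ('i%C *: (U u (A x) - expi_taylor k u (A x))) =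
            nrm (U u (A x) - expi_taylor k u (A x)).
    by rewrite /nrm normrZ normc_def/= expr0n/= add0r expr1n sqrtr1 mul1r.
  rewrite (le_trans (IH _ _ _))//.
    by move=> j jk; rewrite -iterSr; exact: dk.
  by rewrite -iterSr ler_wpM2r ?nrm_ge0// lerXn2r ?nnegrE.
have f0 : f 0 = 0.
  rewrite /f expi_0 (_ : expi_taylor _ 0 x = x) ?subrr ?linear0l//.
  rewrite /expi_taylor big_ord_recl/= expr0 fact0 divr1 scale1r.
  by rewrite big1 ?addr0// => j _; rewrite mulr0 expr0n/= mul0r scale0r.
have cf a b : {within `[a, b], continuous f}.
  apply: continuous_subspaceT => u; apply: differentiable_continuous.
  by apply/derivable1_diffP; have [] := fd u.
have fs : `|f s| <= `|s| * (`|s| ^+ k * nrm (iter k.+1 A x) * nrm r).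
  have [s0|s0] := leP 0 s.
    have [c] := MVT_segment s0 (fun u _ => fd u) (cf 0 s).
    rewrite in_itv/= => /andP[c0 cs]; rewrite f0 !subr0 => ->.
    rewrite normrM mulrC ler_wpM2l// dfb//.
    by rewrite (ger0_norm c0) (ger0_norm s0).
  have [c] := MVT_segment (ltW s0) (fun u _ => fd u) (cf s 0).
  rewrite in_itv/= => /andP[cs c0]; rewrite f0 !sub0r => /eqP.
  rewrite eqr_oppLR => /eqP ->.
  rewrite normrN normrM normrN mulrC ler_wpM2l// dfb//.
  by rewrite (ler0_norm c0) (ltr0_norm s0) lerN2.
have fsE : f s = nrm r ^+ 2.
  by rewrite /f -/r hip nrmE -rmorphXn.
move: fs; rewrite fsE ger0_norm ?sqr_ge0// expr2 exprS -!mulrA mulrA.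
have [-> _|r0] := eqVneq (nrm r) 0.
  by rewrite !mulr_ge0 ?exprn_ge0 ?nrm_ge0.
rewrite !mulrA ler_pM2r// lt_neqAle eq_sym r0; exact: nrm_ge0.
Qed.
End Group.
End InnerProduct.

(** * The Heisenberg charge Q(t): its unitary group and its symmetry *)

Section Heisenberg.
Context {R : realType} {V : completeNormedModType R[i]}.
Context (ip : {dot V for Num.conj}).
Hypothesis hip : hilbert ip.
Variables (H Q : operator V).
Hypotheses (saQ : selfadjoint ip Q).
Hypotheses (exH : expi_exists ip H) (exQ : expi_exists ip Q).

Lemma is_expi_expi A : expi_exists ip A -> is_expi ip A (expi ip A).
Proof. by move=> /xgetPex; exact. Qed.

Let HU := is_expi_expi exH.
Let QU := is_expi_expi exQ.
Local Notation U := (expi ip H).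
Local Notation Qt := (heisenberg ip H Q).

Lemma heisenberg0 : Qt 0 = Q.
Proof.
rewrite /heisenberg oppr0 /compop /totalop; case: (Q) => D f /=.
congr Op.
  by apply/seteqP; split => x /=; rewrite ?(expi_0 HU); [case=> -[] | move=> ?].
by apply/funext => x /=; rewrite !(expi_0 HU).
Qed.

Lemma dom_heisenberg t x : dom (Qt t) x <-> dom Q (U (- t) x).
Proof. by split => [[[]]|]. Qed.

Lemma continuous_expi t x : {for x, continuous (U t)}.
Proof.
apply/cvgrPdist_le => e e0; near=> y.
rewrite -(expi_B HU) nrmE (nrm_expi hip HU) -nrmE.
by near: y; move: e e0; apply/cvgrPdist_le; exact: cvg_id.
Unshelve. all: by end_near.
Qed.

(** The group of Q conjugated by exp(iHt): as an isometry, exp(iHt) is continuous and carries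
    difference quotients over in both directions, domain included. Existence of a group is what
    keeps [expi] of Q(t) from being its default value. *)
Lemma heisenberg_expi t : expi_exists ip (Qt t).
Proof.
pose W (s : R) x := U t (expi ip Q s (U (- t) x)).
exists W; have [[lQ iQ Q0 QD Qc] Qg] := QU; have [[lH iH H0 HD Hc] Hg] := HU.
split.
  split.
  - by move=> s a x y; rewrite /W lH lQ lH.
  - by move=> s x y; rewrite /W !iH iQ iH.
  - by move=> x; rewrite /W Q0 -HD addrN H0.
  - by move=> s r x; rewrite /W QD -(HD (- t) t) addNr H0.
  - move=> x s.
    apply: (@continuous_comp _ _ _ (fun s => expi ip Q s (U (- t) x)) (U t)).
      exact: Qc.
    exact: continuous_expi.
have WE s x : (s^-1)%:C%C *: (W s x - x) =
    U t ((s^-1)%:C%C *: (expi ip Q s (U (- t) x) - U (- t) x)).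
  by rewrite (expi_Z hip HU) (expi_B HU) (expi_KN HU).
move=> x y; split.
  move=> [/dom_heisenberg dx <-].
  have /Qg c : dom Q (U (- t) x) /\ Q (U (- t) x) = Q (U (- t) x) by [].
  under eq_fun do rewrite WE.
  have -> : 'i%C *: Qt t x = U t ('i%C *: Q (U (- t) x)) by rewrite (expi_Z hip HU).
  exact: (continuous_cvg _ (@continuous_expi t _) c).
move=> c.
have : (fun s : R => (s^-1)%:C%C *: (expi ip Q s (U (- t) x) - U (- t) x))
    @ 0^' --> 'i%C *: U (- t) y.
  have -> : 'i%C *: U (- t) y = U (- t) ('i%C *: y) by rewrite (expi_Z hip HU).
  have -> : (fun s : R => (s^-1)%:C%C *: (expi ip Q s (U (- t) x) - U (- t) x)) =
      (fun s : R => U (- t) ((s^-1)%:C%C *: (W s x - x))).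
    by apply/funext => s; rewrite WE (expi_NK HU).
  exact: (continuous_cvg _ (@continuous_expi (- t) _) c).
move/Qg => [d E]; split; first exact/dom_heisenberg.
by rewrite /= E (expi_KN HU).
Qed.

Lemma heisenberg_sym t x y : dom (Qt t) x -> dom (Qt t) y ->
  ip (Qt t x) y = ip x (Qt t y).
Proof.
move=> /dom_heisenberg dx /dom_heisenberg dy.
have [_ _ /(_ (U (- t) y) (Q (U (- t) y)))[_ /(_ (conj dy erefl))]] := saQ.
move=> /(_ _ dx) E; rewrite /= (ip_expi HU) E.
by rewrite (ip_expi HU) opprK.
Qed.

Lemma iter_sym (A : operator V) n x y :
  (forall x y, dom A x -> dom A y -> ip (A x) y = ip x (A y)) ->
  (forall j, (j < n)%N -> dom A (iter j A x)) ->
  (forall j, (j < n)%N -> dom A (iter j A y)) ->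
  ip (iter n A x) y = ip x (iter n A y).
Proof.
move=> symA; elim: n x y => // n IH x y dx dy.
rewrite iterSr IH//=.
- by rewrite symA//; [exact: (dx 0%N) | exact: dy].
- by move=> j jn; rewrite -iterSr; exact: dx.
- by move=> j jn; apply: dy; exact: ltnW.
Qed.
End Heisenberg.

(** * Time-ordered products at the corners of the box *)

Section CornerProducts.
Context {R : realType}.

Definition zeros k (sigma : 'rV[R]_k) : nat :=
  (\sum_i nat_of_bool (sigma ord0 i == 0%R))%N.

Lemma zeros_rcons0 k x (sigma : 'rV[R]_k) :
  zeros (rcons0 x sigma) = ((x == 0%R) + zeros sigma)%N.
Proof.
rewrite /zeros (@big_split_ord _ _ _ 1 k)/= big_ord1 rcons0_l.
by congr (_ + _)%N; apply: eq_bigr => i _; rewrite rcons0_r.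
Qed.

(** In [corner] the sign counts the coordinates equal to t; the factor (-1)^k turns this into a sign
    counting the zeros. Fixing the first coordinate at t or at 0 leaves F or its shift, and Pascal's
    rule merges the two sums. *)
Lemma corner_count (t : R) k (g : 'rV[R]_k -> R) (F : nat -> R) : t != 0 ->
  (forall sigma : 'rV[R]_k, (forall i, sigma ord0 i = 0 \/ sigma ord0 i = t) ->
     g sigma = F (zeros sigma)) ->
  (-1) ^+ k * corner t g =
    \sum_(b < k.+1) (-1) ^+ b * ('C(k, b))%:R * F b.
Proof.
move=> t0; elim: k g F => [|k IH] g F gF.
  rewrite big_ord1 bin0 !expr0 !mul1r /= gF; last by case.
  by rewrite /zeros big_ord0.
have c0 (x : R) (sigma : 'rV[R]_k) : x = 0 \/ x = t ->
    (forall i, sigma ord0 i = 0 \/ sigma ord0 i = t) ->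
    forall i, rcons0 x sigma ord0 i = 0 \/ rcons0 x sigma ord0 i = t.
  move=> x0 s0 j; have [i ->|i ->] := @split_ordP 1 k j.
    by rewrite rcons0_l.
  by rewrite rcons0_r.
rewrite /= exprS mulN1r mulNr mulrBr opprB.
rewrite (IH _ (fun b => F b)); last first.
  move=> sigma s0; rewrite gF; last by apply: c0 => //; right.
  by rewrite zeros_rcons0 (negbTE t0).
rewrite (IH _ (fun b => F b.+1)); last first.
  move=> sigma s0; rewrite gF; last by apply: c0 => //; left.
  by rewrite zeros_rcons0 eqxx.
rewrite [RHS]big_ord_recl/= bin0 expr0 !mul1r.
under [in RHS]eq_bigr do rewrite /bump/= add1n binS natrD mulrDr mulrDl.
rewrite big_split/= addrA; congr (_ + _).
  rewrite [in LHS]big_ord_recl/= bin0 expr0 !mul1r; congr (_ + _).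
  rewrite [in RHS]big_ord_recr/= bin_small// mulr0 mul0r addr0.
  by apply: eq_bigr => i _; rewrite /bump/= add1n.
by rewrite -sumrN; apply: eq_bigr => i _; rewrite exprS mulN1r !mulNr.
Qed.

Context {V : completeNormedModType R[i]}.

Lemma compop_nseq (A : operator V) n (B : operator V) x :
  (dom (foldr compop B (nseq n A)) x <->
    dom B x /\ forall j, (j < n)%N -> dom A (iter j A (B x))) /\
  foldr compop B (nseq n A) x = iter n A (B x).
Proof.
elim: n => [|n [dE aE]] /=; first by split => //; split => [|[]].
split; last by rewrite aE.
rewrite /= aE; split => [[/dE[dB dA] dn]|[dB dA]].
  by split => // j; rewrite ltnS leq_eqVlt => /predU1P[->//|]; exact: dA.
split; last exact: dA.
by apply/dE; split => // j jn; apply: dA; exact: ltnW.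
Qed.

Lemma sorted_two (t : R) (s : seq R) : 0 < t -> all (fun x => (x == 0) || (x == t)) s ->
  sorted (fun x y => y <= x) s ->
  s = nseq (size s - count_mem 0 s) t ++ nseq (count_mem 0 s) 0.
Proof.
move=> t0; elim: s => // x s IH /= /andP[xt st] ps.
have /IH E := path_sorted ps.
case/orP: xt => /eqP xE; last first.
  rewrite xE (gt_eqF t0) add0n subSn ?count_size//=; congr (_ :: _); exact: E.
have s0 : all (pred1 0) s.
  apply/allP => y ys; have /allP/(_ y ys) := order_path_min (fun a b c ab bc => le_trans bc ab) ps.
  rewrite xE => y0; have /allP/(_ y ys)/orP[//|/eqP yt] := st.
  by move: y0; rewrite yt leNgt t0.
rewrite xE eqxx add1n; have /eqP cs : count_mem 0 s == size s by rewrite -all_count.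
by rewrite cs subnn/=; congr (_ :: _); apply/all_pred1P.
Qed.

(** Each factor depends on its time alone, so the product is determined by the sorted list of times,
    however [sort] breaks ties. At a corner this list is a block of t followed by a block of 0. *)
Lemma TQ_corner (Qt : R -> operator V) (t : R) k (sigma : 'rV[R]_k) : 0 < t ->
  (forall i, sigma ord0 i = 0 \/ sigma ord0 i = t) ->
  TQ Qt sigma = foldr compop (foldr compop (totalop id)
     (nseq (zeros sigma) (Qt 0))) (nseq (k - zeros sigma) (Qt t)).
Proof.
move=> t0 s0; rewrite /TQ /time_ordered.
set s := sort _ _.
have -> : \big[compop/totalop id]_(i <- s) Qt (sigma ord0 i) =
   foldr compop (totalop id) (map Qt (map (sigma ord0) s)).
  by rewrite -map_comp unlock /reducebig; elim: s => //= i s ->.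
have ps : perm_eq (map (sigma ord0) s) (map (sigma ord0) (enum 'I_k)).
  by apply: perm_map; rewrite /s perm_sort.
have -> : map (sigma ord0) s = nseq (k - zeros sigma) t ++ nseq (zeros sigma) 0.
  have -> : zeros sigma = count_mem 0 (map (sigma ord0) s).
    rewrite (permP ps) count_map -sum1_count big_enum_cond/= /zeros.
    by rewrite [RHS]big_mkcond.
  have ks : size (map (sigma ord0) s) = k.
    by rewrite (perm_size ps) size_map size_enum_ord.
  have a0 : all (fun x => (x == 0) || (x == t)) (map (sigma ord0) s).
    by apply/allP => x /mapP[i _ ->]; have [->|->] := s0 i; rewrite eqxx ?orbT.
  have := sorted_two t0 a0; rewrite ks; apply.
  by rewrite sorted_map; apply: sort_sorted => i j; exact: le_total.
by rewrite map_cat foldr_cat !map_nseq.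
Qed.

End CornerProducts.

(** * The generating function *)

Section PowerSeries.
Context {R : realType}.

(** The bound doubles because real and imaginary parts are estimated separately; only the order of
    magnitude matters later. *)
Lemma cplx_norm_lim (T : Type) (F : set_system T) (FF : ProperFilter F)
    (f : T -> Cplx R) (s : Cplx R) (c : R) :
  f @ F --> s -> (\forall x \near F, `|f x| <= c%:C%C) ->
  `|s| <= (c + c)%:C%C.
Proof.
move=> /cplx_cvgP[fR fI] fc; apply: (le_trans (norm_le_ReIm s)).
rewrite lecR lerD//.
  have cv : `|complex.Re (f x)| @[x --> F] --> `|complex.Re s| by exact: cvg_norm.
  rewrite -(cvg_lim _ cv)//; apply: limr_le; first by apply/cvg_ex; eexists; exact: cv.
  by apply: filterS fc => x; exact: Re_le_norm.
have cv : `|complex.Im (f x)| @[x --> F] --> `|complex.Im s| by exact: cvg_norm.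
rewrite -(cvg_lim _ cv)//; apply: limr_le; first by apply/cvg_ex; eexists; exact: cv.
by apply: filterS fc => x; exact: Im_le_norm.
Qed.

Lemma cplx_cvg_sum (T : Type) (F : set_system T) (FF : Filter F) K
    (f : nat -> T -> Cplx R) (a : nat -> Cplx R) :
  (forall i, f i x @[x --> F] --> a i) ->
  \sum_(i < K) f i x @[x --> F] --> \sum_(i < K) a i.
Proof.
move=> fa; elim: K => [|K IH].
  have -> : (fun x => \sum_(i < 0) f i x) = fun=> (0 : Cplx R).
    by apply/funext => x; rewrite big_ord0.
  by rewrite [X in _ --> X]big_ord0; exact: cvg_cst.
have -> : (fun x => \sum_(i < K.+1) f i x) = fun x => \sum_(i < K) f i x + f K x.
  by apply/funext => x; rewrite big_ord_recr.
have -> : \sum_(i < K.+1) a i = \sum_(i < K) a i + a K by rewrite big_ord_recr.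
by apply: (@cvgD _ (Cplx R)); [exact: IH | exact: fa].
Qed.

Lemma geometric_tail (q : R) K N : 0 <= q <= 2^-1 -> (K <= N)%N ->
  \sum_(K <= k < N) q ^+ k <= 2 * q ^+ K.
Proof.
move=> /andP[q0 q1] KN.
(* The subtracted term makes the induction close: q^N <= 2 q^N - 2 q^(N+1) holds because q <=
   1/2. *)
suff : \sum_(K <= k < N) q ^+ k <= 2 * q ^+ K - 2 * q ^+ N.
  by move=> /le_trans; apply; rewrite lerBlDr lerDl mulr_ge0// exprn_ge0.
elim: N KN => [|N IH]; first by rewrite leqn0 => /eqP ->; rewrite big_geq// subrr.
rewrite leq_eqVlt => /predU1P[->|]; first by rewrite big_geq// subrr.
rewrite ltnS => KN; rewrite big_nat_recr//=.
apply: (le_trans (lerD (IH KN) (lexx _))).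
have qN : 0 <= q ^+ N by rewrite exprn_ge0.
rewrite exprS; nra.
Qed.

(** Convergence at l0 bounds the terms there by a constant D, so for |l| <= |l0| / 2 the tail from K
    on is at most D times a geometric one of ratio |l| / |l0|. *)
Lemma power_series_taylor (a : nat -> Cplx R) (l0 : R) K : l0 != 0 ->
  cvgn (series (fun k => a k * (l0%:C%C : Cplx R) ^+ k : Cplx R)) ->
  exists C : R, forall (l : R) (s : Cplx R), `|l| <= `|l0| / 2 ->
    series (fun k => a k * (l%:C%C : Cplx R) ^+ k : Cplx R) @ \oo --> s ->
    `|s - \sum_(j < K) a j * (l%:C%C : Cplx R) ^+ j| <= (C * `|l| ^+ K)%:C%C.
Proof.
move=> l00 /cvg_series_cvg_0 cv0.
have cb := cvg_seq_bounded (cvgP _ cv0).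
have [D D0 HD] : exists2 D : R, 0 <= D & forall k, `|a k| * (`|l0| ^+ k)%:C%C <= D%:C%C.
  have [d [dreal Hd]] := cb.
  have [d' dE] := complex_realP _ dreal.
  exists (`|d'| + 1); first by rewrite addr_ge0.
  move=> k; have := Hd ((`|d'| + 1)%:C%C) _ k I; rewrite /= normrM normrX.
  have -> : `|(l0%:C%C : Cplx R)| = (`|l0|)%:C%C by rewrite normc_def/= expr0n/= addr0 sqrtr_sqr.
  rewrite rmorphXn; apply.
  by rewrite dE ltcR (le_lt_trans (ler_norm _))// ltrDl.
(* The inner 2 bounds the geometric tail, the outer 2 is the loss in [cplx_norm_lim]. *)
exists (2 * (D * (2 * (`|l0| ^- K)))) => l s ll cs.
have q0 : 0 < `|l0| by rewrite normr_gt0.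
set q := `|l| / `|l0|.
have q01 : 0 <= q <= 2^-1.
  by rewrite divr_ge0//= ler_pdivrMr// mulrC.
have bound N : (K <= N)%N ->
   `|series (fun k => a k * (l%:C%C : Cplx R) ^+ k : Cplx R) N -
     \sum_(j < K) a j * (l%:C%C : Cplx R) ^+ j| <= (D * (2 * q ^+ K))%:C%C.
  move=> KN; rewrite -(big_mkord xpredT (fun j => a j * (l%:C%C : Cplx R) ^+ j)).
  rewrite sub_series_geq//.
  apply: (le_trans (ler_norm_sum _ _ _)).
  apply: (@le_trans _ _ (D * \sum_(K <= k < N) q ^+ k)%:C%C); last first.
    by rewrite lecR ler_wpM2l// geometric_tail.
  rewrite mulr_sumr rmorph_sum/=; apply: ler_sum => k _.
  rewrite normrM normrX.
  have -> : `|(l%:C%C : Cplx R)| = (`|l|)%:C%C by rewrite normc_def/= expr0n/= addr0 sqrtr_sqr.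
  have -> : (`|l|)%:C%C ^+ k = (`|l0| ^+ k)%:C%C * (q ^+ k)%:C%C :> R[i].
    by rewrite -rmorphM/= -exprMn -rmorphXn /q mulrC divfK// gt_eqF.
  by rewrite mulrA rmorphM ler_wpM2r// ler0c exprn_ge0//; case/andP: q01.
have -> : 2 * (D * (2 * `|l0| ^- K)) * `|l| ^+ K = D * (2 * q ^+ K) + D * (2 * q ^+ K).
  by rewrite /q exprMn exprVn; ring.
have cv : series (fun k => a k * (l%:C%C : Cplx R) ^+ k : Cplx R) N -
     \sum_(j < K) a j * (l%:C%C : Cplx R) ^+ j @[N --> \oo] -->
   (s - \sum_(j < K) a j * (l%:C%C : Cplx R) ^+ j : Cplx R).
  by apply: (@cvgB _ (Cplx R)); [exact: cs | exact: cvg_cst].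
apply: (cplx_norm_lim _ cv); near=> N; apply: bound; near: N; exact: nbhs_infty_ge.
Unshelve. all: by end_near.
Qed.

(** After division by |l|^j it remains that |z| <= C |l|, which fails for small l unless z = 0. *)
Lemma small_eq0 (z : R[i]) (C : R) j :
  (\forall l \near (0 : R)^', `|z| * (`|l| ^+ j)%:C%C <= (C * `|l| ^+ j.+1)%:C%C) ->
  z = 0.
Proof.
move=> H; apply/eqP; rewrite -normr_eq0; apply/eqP.
have zE : `|z| = (complex.Re `|z|)%:C%C by rewrite RRe_real// normr_real.
set r := complex.Re `|z| in zE; rewrite zE; congr (_%:C%C).
have r0 : 0 <= r by rewrite -lecR -zE normr_ge0.
apply/eqP; rewrite eq_le r0 andbT leNgt; apply/negP => rgt0.
have C1 : 0 < `|C| + 1 by rewrite ltr_wpDl.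
have rC : 0 < r / (`|C| + 1) by rewrite divr_gt0.
suff /filter_ex[? []] : \forall l \near (0 : R)^', False.
near=> l.
have l0 : l != 0 by near: l; exact: nbhs_dnbhs_neq.
have lr : `|l| < r / (`|C| + 1) by near: l; exact: dnbhs0_lt.
have : `|z| * (`|l| ^+ j)%:C%C <= (C * `|l| ^+ j.+1)%:C%C by near: l.
rewrite zE -rmorphM lecR exprSr mulrA [C * _]mulrC -mulrA [X in _ <= X]mulrC.
rewrite ler_pM2r ?exprn_gt0 ?normr_gt0// => rl.
have lC : `|l| * (`|C| + 1) < r by rewrite -ltr_pdivlMr.
have := ler_wpM2r (normr_ge0 l) (ler_norm C).
have := normr_ge0 l.
by move: lC rl; rewrite mulrDr mulr1 [`|l| * _]mulrC; lra.
Unshelve. all: by end_near.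
Qed.

(** Both sides range over a + b < K; on the right the terms are grouped by total degree. *)
Lemma triangular_sum (S : nmodType) K (G : nat -> nat -> S) :
  \sum_(b < K) \sum_(a < K - b) G a b = \sum_(j < K) \sum_(b < j.+1) G (j - b)%N b.
Proof.
elim: K => [|K IH]; first by rewrite !big_ord0.
rewrite big_ord_recr [RHS]big_ord_recr/= -IH subSnn big_ord1.
rewrite [X in _ = _ + X]big_ord_recr/= subnn addrA; congr (_ + _).
rewrite -big_split/=; apply: eq_bigr => b _.
by rewrite subSn ?big_ord_recr// ltnW.
Qed.
End PowerSeries.

(** * Taylor coefficients of chi and their identification with the moments *)

Section GeneratingFunction.
Context {R : realType} {V : completeNormedModType R[i]}.
Context (ip : {dot V for Num.conj}).
Hypothesis hip : hilbert ip.

Lemma conj_iR (l : R) : ('i%C * (- l)%:C%C)^* = 'i%C * l%:C%C :> R[i].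
Proof.
by apply/eqP; rewrite eq_complex/=; apply/andP; split; apply/eqP; ring.
Qed.

Lemma iRN (l : R) : 'i%C * (- l)%:C%C = - ('i%C * l%:C%C) :> R[i].
Proof. by rewrite rmorphN mulrN. Qed.

Lemma norm_iR (l : R) : `|'i%C * l%:C%C : R[i]| = (`|l|)%:C%C.
Proof.
rewrite normrM [`|'i%C|](_ : _ = 1) ?mul1r.
  by rewrite normc_def/= expr0n/= addr0 sqrtr_sqr.
by rewrite normc_def/= expr0n/= add0r expr1n sqrtr1.
Qed.

Definition cnorm (z : R[i]) : R := complex.Re `|z|.
Arguments cnorm : simpl never.

Lemma cnormE z : `|z| = (cnorm z)%:C%C.
Proof. by rewrite /cnorm RRe_real// normr_real. Qed.

Lemma norm_ip_le x y : `|ip x y| <= (nrm x * nrm y)%:C%C.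
Proof. by rewrite rmorphM/= -!nrmE ip_CauchySchwarz. Qed.

Section Pair.
Variables (A B : operator V) (U W : R -> V -> V) (x : V).
Hypotheses (BU : is_expi ip B U) (AW : is_expi ip A W).
Hypothesis symA : forall x y, dom A x -> dom A y -> ip (A x) y = ip x (A y).
Hypothesis dAB : forall a b,
  (forall j, (j < b)%N -> dom B (iter j B x)) /\
  (forall j, (j < a)%N -> dom A (iter j A (iter b B x))).

Let coef (a : nat) (l : R) : R[i] := ('i%C * l%:C%C) ^+ a / a`!%:R.

Lemma ip_expi_taylor K l :
  `|ip (W l (U (- l) x)) x -
    \sum_(b < K) \sum_(a < K - b) coef b (- l) * coef a l *
       ip (iter a A (iter b B x)) x|
  <= (`|l| ^+ K * \sum_(b < K.+1) nrm (iter b B x) * nrm (iter (K - b) A x))%:C%C.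
Proof.
pose y := W (- l) x.
pose r := U (- l) x - expi_taylor B K (- l) x.
pose rb (b : nat) := y - expi_taylor A (K - b) (- l) x.
have dA j : dom A (iter j A x) by have [_ /(_ j (ltnSn j))] := dAB j.+1 0.
have dB j : dom B (iter j B x) by have [/(_ j (ltnSn j))] := dAB 0 j.+1.
(* The form is conjugate linear in its second argument, and conjugation undoes the sign of -l. *)
have cN a : (coef a (- l))^* = coef a l.
  by rewrite /coef rmorphM rmorphXn/= conj_iR fmorphV rmorph_nat.
have E : ip (W l (U (- l) x)) x - \sum_(b < K) \sum_(a < K - b)
    coef b (- l) * coef a l * ip (iter a A (iter b B x)) x =
    \sum_(b < K) coef b (- l) * ip (iter b B x) (rb b) + ip r y.
  rewrite (ip_expi AW) -/y -[U (- l) x](subrK (expi_taylor B K (- l) x)) -/r.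
  rewrite linearDl/= [X in X - _]addrC addrAC; congr (_ + _).
  rewrite /expi_taylor linear_sumlz/= -sumrB; apply: eq_bigr => b _.
  rewrite linearZl_LR/= -/(coef b (- l)).
  have -> : ip (iter b B x) y = ip (iter b B x) (rb b) +
     \sum_(a < K - b) coef a l * ip (iter a A (iter b B x)) x.
    rewrite -{1}[y](subrK (expi_taylor A (K - b) (- l) x)) -/(rb b) linearDr/=.
    congr (_ + _); rewrite /expi_taylor linear_sumr/=; apply: eq_bigr => a _.
    rewrite linearZr_LR/= -/(coef a (- l)) cN; congr (_ * _).
    apply: esym; apply: (iter_sym symA) => j _; last exact: dA.
    by have [_ /(_ j (ltnSn j))] := dAB j.+1 b.
  rewrite mulrDr mulr_sumr.
  under [X in _ + X - _]eq_bigr do rewrite mulrA.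
  by rewrite addrK.
(* The term b = K of the bound is reserved for the remainder [r] of the expansion in B. *)
rewrite E big_ord_recr/= subnn mulrDr rmorphD/=.
apply: (le_trans (ler_normD _ _)); apply: lerD; last first.
  apply: (le_trans (norm_ip_le _ _)); rewrite lecR (nrm_expi hip AW) mulrA.
  rewrite ler_wpM2r ?nrm_ge0//.
  by have := expi_taylor_le hip BU (- l) (fun j (_ : (j < K)%N) => dB j); rewrite normrN.
rewrite mulr_sumr rmorph_sum/=; apply: (le_trans (ler_norm_sum _ _ _)).
apply: ler_sum => b _; rewrite normrM.
have cb : `|coef b (- l)| <= (`|l| ^+ b)%:C%C.
  rewrite /coef normrM normrX norm_iR normrN normfV normr_nat rmorphXn/=.
  by rewrite ler_piMr ?exprn_ge0 ?ler0c// invf_le1 ?ltr0n ?fact_gt0// ler1n fact_gt0.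
apply: (@le_trans _ _ ((`|l| ^+ b)%:C%C *
    (nrm (iter b B x) * (`|l| ^+ (K - b) * nrm (iter (K - b) A x)))%:C%C)).
  apply: ler_pM => //; apply: (le_trans (norm_ip_le _ _)).
  rewrite lecR ler_wpM2l ?nrm_ge0//.
  by have := expi_taylor_le hip AW (- l) (fun j (_ : (j < K - b)%N) => dA j); rewrite normrN.
have -> : `|l| ^+ K = `|l| ^+ b * `|l| ^+ (K - b).
  by rewrite -exprD subnKC// ltnW.
by rewrite -rmorphM lecR le_eqVlt; apply/orP; left; apply/eqP; ring.
Qed.

(* <x| (A - B)^k x>, with all factors A written to the left *)
Definition ordered_moment k : R[i] :=
  \sum_(b < k.+1) ((-1) ^+ b * ('C(k, b))%:R) * ip (iter (k - b) A (iter b B x)) x.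

(** In total degree j, (-il)^b (il)^(j-b) / (b! (j-b)!) equals (il)^j / j! times (-1)^b C(j, b). *)
Lemma generating_taylor K l :
  `|ip (W l (U (- l) x)) x - \sum_(j < K) coef j l * ordered_moment j|
  <= (`|l| ^+ K * \sum_(b < K.+1) nrm (iter b B x) * nrm (iter (K - b) A x))%:C%C.
Proof.
have := ip_expi_taylor K l; rewrite (triangular_sum K (fun a b =>
  coef b (- l) * coef a l * ip (iter a A (iter b B x)) x)).
congr (`|_ - _| <= _); apply: eq_bigr => j _.
rewrite /ordered_moment mulr_sumr; apply: eq_bigr => b _.
rewrite (mulrA (coef j l)); congr (_ * _).
have bj : (b <= j)%N by rewrite -ltnS.
have jf : j`!%:R = 'C(j, b)%:R * (b`!%:R * (j - b)`!%:R) :> R[i].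
  by rewrite -!natrM bin_fact.
have wj : ('i%C * l%:C%C) ^+ j = ('i%C * l%:C%C) ^+ b * ('i%C * l%:C%C) ^+ (j - b) :> R[i].
  by rewrite -exprD subnKC.
have n0 n : n`!%:R != 0 :> R[i] by rewrite pnatr_eq0 -lt0n fact_gt0.
have c0 : 'C(j, b)%:R != 0 :> R[i] by rewrite pnatr_eq0 -lt0n bin_gt0.
rewrite /coef iRN (exprNn ('i%C * l%:C%C)) jf wj; have := n0 b; have := n0 (j - b)%N; move: c0.
move: (('i%C * l%:C%C) ^+ b) (('i%C * l%:C%C) ^+ (j - b)) ((-1) ^+ b).
move: (b`!%:R : R[i]) ((j - b)`!%:R : R[i]) ('C(j, b)%:R : R[i]) => f1 f2 c w1 w2 s.
move=> c0 f20 f10; field.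
by rewrite c0 f10 f20.
Qed.
End Pair.

(** Every word Q(t)^a Q(0)^b occurs at a corner of the box of dimension b + a. Through this,
    [TQ_well_defined] provides the domains and the summable bounds for all words in the Taylor
    expansion. *)
Lemma TQ_word (Qt : R -> operator V) (t : R) a b x : 0 < t ->
  exists2 sigma : 'rV[R]_(b + a),
    (forall i, sigma ord0 i = 0 \/ sigma ord0 i = t) &
    TQ Qt sigma x = iter a (Qt t) (iter b (Qt 0) x) /\
    (dom (TQ Qt sigma) x ->
      (forall j, (j < b)%N -> dom (Qt 0) (iter j (Qt 0) x)) /\
      (forall j, (j < a)%N -> dom (Qt t) (iter j (Qt t) (iter b (Qt 0) x)))).
Proof.
move=> t0; pose sigma : 'rV[R]_(b + a) := row_mx (const_mx 0) (const_mx t).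
have s0 i : sigma ord0 i = 0 \/ sigma ord0 i = t.
  have [j ->|j ->] := split_ordP i.
    by left; rewrite /sigma row_mxEl mxE.
  by right; rewrite /sigma row_mxEr mxE.
have zs : zeros sigma = b.
  rewrite /zeros big_split_ord/=.
  under eq_bigr do rewrite /sigma row_mxEl mxE eqxx.
  under [X in (_ + X)%N]eq_bigr do rewrite /sigma row_mxEr mxE (gt_eqF t0).
  by rewrite !sum_nat_const !card_ord muln1 muln0 addn0.
exists sigma => //; rewrite (TQ_corner Qt t0 s0) zs addKn.
have [dA ->] := compop_nseq (Qt t) a (foldr compop (totalop id) (nseq b (Qt 0))) x.
have [dB E] := compop_nseq (Qt 0) b (totalop id) x.
rewrite E; split => // /dA[/dB[_ db]]; rewrite E => da.
by split.
Qed.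

Lemma nrm_iter_sqr (A : operator V) n x :
  (forall x y, dom A x -> dom A y -> ip (A x) y = ip x (A y)) ->
  (forall j, dom A (iter j A x)) ->
  nrm (iter n A x) ^+ 2 = complex.Re (ip (iter (n + n) A x) x).
Proof.
move=> sA dA; rewrite iterD (iter_sym sA) => [|j _|j _]; [|by rewrite -iterD|by []].
by rewrite hip nrmE -rmorphXn.
Qed.

Variables (H Q : operator V) (v : nat -> V) (t : R).
Hypotheses (saQ : selfadjoint ip Q).
Hypotheses (exH : expi_exists ip H) (exQ : expi_exists ip Q).
Hypothesis TQw : TQ_well_defined ip v (heisenberg ip H Q).
Hypothesis t0 : 0 < t.
Local Notation Qt := (heisenberg ip H Q).

Let Q0 : Qt 0 = Q := heisenberg0 Q exH.

Let symQt s x y : dom (Qt s) x -> dom (Qt s) y -> ip (Qt s x) y = ip x (Qt s y).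
Proof. exact: heisenberg_sym. Qed.

Let symQ x y : dom Q x -> dom Q y -> ip (Q x) y = ip x (Q y).
Proof. by rewrite -Q0; exact: symQt. Qed.

Let dW n a b : (forall j, (j < b)%N -> dom Q (iter j Q (v n))) /\
  (forall j, (j < a)%N -> dom (Qt t) (iter j (Qt t) (iter b Q (v n)))).
Proof.
have [sigma s0 []] := TQ_word Qt a b (v n) t0; rewrite Q0 => _; apply.
by have [+ _ _] := TQw (b + a); exact.
Qed.

(** Here the two computations meet: at a corner with b zeros the ordered product is the word
    Q(t)^(k-b) Q^b, and there are C(k, b) such corners. *)
Lemma ordered_moment_corner k n : ordered_moment (Qt t) Q (v n) k =
  (((-1) ^+ k * corner t (fun tau : 'rV[R]_k => complex.Re (ip (TQ Qt tau (v n)) (v n)))) +i*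
   ((-1) ^+ k * corner t (fun tau : 'rV[R]_k => complex.Im (ip (TQ Qt tau (v n)) (v n)))))%C.
Proof.
have E (sigma : 'rV[R]_k) : (forall i, sigma ord0 i = 0 \/ sigma ord0 i = t) ->
    TQ Qt sigma (v n) = iter (k - zeros sigma) (Qt t) (iter (zeros sigma) Q (v n)).
  move=> s0; rewrite (TQ_corner Qt t0 s0) Q0.
  rewrite (compop_nseq (Qt t) _ _ (v n)).2.
  by rewrite (compop_nseq Q _ (totalop id) (v n)).2.
rewrite (@corner_count _ _ _ _ (fun b => complex.Re
    (ip (iter (k - b) (Qt t) (iter b Q (v n))) (v n)))) ?gt_eqF//; last first.
  by move=> sigma /E ->.
rewrite (@corner_count _ _ _ _ (fun b => complex.Im
    (ip (iter (k - b) (Qt t) (iter b Q (v n))) (v n)))) ?gt_eqF//; last first.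
  by move=> sigma /E ->.
have cE b : (-1) ^+ b * 'C(k, b)%:R = ((-1) ^+ b * 'C(k, b)%:R)%:C%C :> R[i].
  by rewrite rmorphM rmorphXn rmorphN rmorph1 rmorph_nat.
rewrite /ordered_moment.
under eq_bigr do rewrite cE.
apply/eqP; rewrite eq_complex; apply/andP; split; apply/eqP => /=.
  by rewrite Re_sum; apply: eq_bigr => b _; rewrite Re_realM.
rewrite (big_morph (fun z : R[i] => complex.Im z) (id1 := 0) (op1 := +%R)) => [||//].
  by apply: eq_bigr => b _; case: (ip _ _) => ? ? /=; rewrite mul0r addr0.
by move=> [? ?] [? ?].
Qed.

Let word_bound a b : exists2 beta : nat -> R, cvgn (series beta) &
  forall n, `|ip (iter a (Qt t) (iter b Q (v n))) (v n)| <= (beta n)%:C%C.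
Proof.
have [_ _ /(_ t)[beta cbeta bb]] := TQw (b + a).
exists beta => // n; have [sigma s0 [E _]] := TQ_word Qt a b (v n) t0.
rewrite Q0 in E; rewrite -E; apply: bb => i.
by have [->|->] := s0 i; rewrite ?normr0 ?gtr0_norm// ltW.
Qed.

Let sum_bound K (f : nat -> nat -> R) :
  (forall b, exists2 beta : nat -> R, cvgn (series beta) & forall n, f b n <= beta n) ->
  exists2 beta : nat -> R, cvgn (series beta) & forall n, \sum_(b < K) f b n <= beta n.
Proof.
move=> hf; elim: K => [|K [beta cb fb]].
  exists (fun=> 0 : R); last by move=> n; rewrite big_ord0.
  have -> : series (fun=> 0 : R) = cst 0.
    by apply/funext => N; rewrite /series/= big1.
  exact: is_cvg_cst.
have [beta' cb' fb'] := hf K.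
exists (beta \+ beta'); first by rewrite seriesD; exact: is_cvgD.
by move=> n; rewrite big_ord_recr/= lerD.
Qed.

Lemma ordered_moment_bound k : exists2 beta : nat -> R, cvgn (series beta) &
  forall n, `|ordered_moment (Qt t) Q (v n) k| <= (beta n)%:C%C.
Proof.
have [|beta cb mb] := @sum_bound k.+1 (fun b n => cnorm (((-1) ^+ b * 'C(k, b)%:R) *
    ip (iter (k - b) (Qt t) (iter b Q (v n))) (v n))).
  move=> b; have [beta cb bb] := word_bound (k - b) b.
  exists (fun n => 'C(k, b)%:R * beta n); first exact: is_cvg_seriesZ.
  move=> n; rewrite -lecR -cnormE normrM normrM normrX normrN1 expr1n mul1r.
  by rewrite normr_nat rmorphM/= rmorph_nat ler_wpM2l.
exists beta => // n; rewrite /ordered_moment.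
apply: (le_trans (ler_norm_sum _ _ _)).
apply: (@le_trans _ _ (\sum_(b < k.+1) cnorm (((-1) ^+ b * 'C(k, b)%:R) *
    ip (iter (k - b) (Qt t) (iter b Q (v n))) (v n)))%:C%C); last by rewrite lecR.
by rewrite rmorph_sum/=; apply: ler_sum => b _; rewrite -cnormE.
Qed.

(** A product of norms is at most the sum of their squares, and these squares are expectations of
    the pure words Q^(2b) and Q(t)^(2(K-b)), which have summable bounds. *)
Lemma taylor_error_bound K : exists2 beta : nat -> R, cvgn (series beta) &
  forall n, \sum_(b < K.+1) nrm (iter b Q (v n)) * nrm (iter (K - b) (Qt t) (v n)) <= beta n.
Proof.
apply: (@sum_bound K.+1 (fun b n => nrm (iter b Q (v n)) * nrm (iter (K - b) (Qt t) (v n)))).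
move=> b; have [b1 c1 h1] := word_bound 0 (b + b).
have [b2 c2 h2] := word_bound ((K - b) + (K - b)) 0.
exists (b1 \+ b2); first by rewrite seriesD; exact: is_cvgD.
move=> n; change ((b1 \+ b2) n) with (b1 n + b2 n); set x := nrm _; set y := nrm _.
have xE : x ^+ 2 <= b1 n.
  rewrite /x nrm_iter_sqr//; last by move=> j; have [/(_ j (ltnSn j))] := dW n 0 j.+1.
  exact: (le_trans (ler_norm _) (Re_le_norm (h1 n))).
have yE : y ^+ 2 <= b2 n.
  rewrite /y nrm_iter_sqr//; last 2 first.
  - exact: symQt.
  - by move=> j; have [_ /(_ j (ltnSn j))] := dW n j.+1 0.
  exact: (le_trans (ler_norm _) (Re_le_norm (h2 n))).
have := sqr_ge0 (x - y); have := nrm_ge0 (iter b Q (v n)); rewrite -/x.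
have := nrm_ge0 (iter (K - b) (Qt t) (v n)); rewrite -/y; nra.
Qed.

(** The candidate for the k-th moment: the expectation of (Q(t) - Q)^k expanded with every Q(t) to
    the left. *)
Definition moment_sum k : Cplx R := limn (series (fun n => ordered_moment (Qt t) Q (v n) k : Cplx R)).

Lemma moment_sum_cvg k :
  series (fun n => ordered_moment (Qt t) Q (v n) k : Cplx R) @ \oo --> moment_sum k.
Proof.
have [beta cb mb] := ordered_moment_bound k.
have cv := @cplx_series_cvg _ (fun n => ordered_moment (Qt t) Q (v n) k) beta mb cb.
by rewrite /moment_sum (cvg_lim _ cv).
Qed.

(** The series defining chi is split into f - P, dominated by the Taylor errors of the single
    vectors, and P, a finite combination of the convergent series [moment_sum]. This also proves
    that the series for chi converges. *)
Lemma charge_gf_taylor K : exists C : R, forall l : R,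
  `|charge_gf ip v H Q t l -
     \sum_(j < K) (('i%C * l%:C%C) ^+ j / j`!%:R) * moment_sum j| <=
  (C * `|l| ^+ K)%:C%C.
Proof.
have [beta cb eb] := taylor_error_bound K.
exists (2 * limn (series beta)) => l.
pose f n : Cplx R := ip (expi ip (Qt t) l (expi ip Q (- l) (v n))) (v n).
pose P n : Cplx R := \sum_(j < K) (('i%C * l%:C%C) ^+ j / j`!%:R) *
   ordered_moment (Qt t) Q (v n) j.
have beta0 n : 0 <= beta n.
  apply: le_trans (eb n); apply: sumr_ge0 => b _.
  by apply: mulr_ge0; exact: nrm_ge0.
have fP n : `|f n - P n| <= (`|l| ^+ K * beta n)%:C%C.
  have QU := is_expi_expi exQ.
  have AW := is_expi_expi (@heisenberg_expi _ _ ip hip H Q exH exQ t).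
  apply: (le_trans (generating_taylor QU AW (@symQt t) (dW n) K l)).
  by rewrite lecR ler_wpM2l ?exprn_ge0.
have cB : cvgn (series (fun n => `|l| ^+ K * beta n)) by exact: is_cvg_seriesZ.
have cX := @cplx_series_cvg _ (fun n => f n - P n) _ fP cB.
set X : Cplx R := (_ +i* _)%C in cX.
have cP : series P @ \oo --> (\sum_(j < K) ((('i%C * l%:C%C) ^+ j / j`!%:R) *
     moment_sum j : Cplx R) : Cplx R).
  have -> : series P = (fun N => \sum_(j < K) ((('i%C * l%:C%C) ^+ j / j`!%:R : Cplx R) *
      series (fun n => ordered_moment (Qt t) Q (v n) j : Cplx R) N)).
    apply/funext => N; rewrite /series /P/= exchange_big/=.
    by apply: eq_bigr => j _; rewrite mulr_sumr.
  apply: (@cplx_cvg_sum _ _ _ _ K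
    (fun j N => (('i%C * l%:C%C) ^+ j / j`!%:R : Cplx R) *
      series (fun n => ordered_moment (Qt t) Q (v n) j : Cplx R) N)
    (fun j => (('i%C * l%:C%C) ^+ j / j`!%:R : Cplx R) * moment_sum j)) => j.
  by apply: cvgMr; exact: moment_sum_cvg.
set S : Cplx R := \sum_(j < K) _ in cP *.
have cf : series f @ \oo --> X + S.
  have -> : series f = series (fun n => f n - P n) \+ series P.
    apply/funext => N; rewrite /series/= -big_split/=.
    by apply: eq_bigr => n _; rewrite subrK.
  by apply: (@cvgD _ (Cplx R)); [exact: cX | exact: cP].
have -> : charge_gf ip v H Q t l = X + S.
  by apply: (@cvg_lim (Cplx R)); [exact: norm_hausdorff | exact: cf].
rewrite addrK.
have -> : 2 * limn (series beta) * `|l| ^+ K =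
    `|l| ^+ K * limn (series beta) + `|l| ^+ K * limn (series beta) by ring.
apply: (cplx_norm_lim _ cX); near=> N.
apply: (@le_trans _ _ (series (fun n => `|l| ^+ K * beta n) N)%:C%C).
  rewrite /series/= rmorph_sum/=; apply: (le_trans (ler_norm_sum _ _ _)).
  by apply: ler_sum => n _; exact: fP.
rewrite lecR /series/= -mulr_sumr ler_wpM2l ?exprn_ge0//.
apply: (@nondecreasing_cvgn_le _ (series beta)) => //.
by apply: nondecreasing_series.
Unshelve. all: by end_near.
Qed.

(** Strong induction on j: once the lower coefficients agree, the two expansions of chi to order j+1
    differ by the j-th term alone, which is therefore O(|l|^(j+1)) and has coefficient 0. *)
Lemma has_moments_unique (m : nat -> R[i]) j :
  has_moments (charge_gf ip v H Q t) m -> m j = moment_sum j.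
Proof.
move=> /nbhs_ballP[d /= d0 Hd].
have Hd' (l : R) : `|l| < d ->
    series (fun k => ('i%C * l%:C%C) ^+ k / k`!%:R * m k : Cplx R) @ \oo
      --> charge_gf ip v H Q t l.
  by move=> ld; apply: Hd; rewrite /ball/= sub0r normrN.
pose a k : Cplx R := 'i%C ^+ k / k`!%:R * m k.
have aE (l : R) k : ('i%C * l%:C%C) ^+ k / k`!%:R * m k = a k * (l%:C%C : Cplx R) ^+ k :> R[i].
  by rewrite /a exprMn; ring.
have Ha (l : R) : `|l| < d ->
    series (fun k => a k * (l%:C%C : Cplx R) ^+ k : Cplx R) @ \oo --> charge_gf ip v H Q t l.
  move=> /Hd'; have -> : (fun k => ('i%C * l%:C%C) ^+ k / k`!%:R * m k : Cplx R) =
    (fun k => a k * (l%:C%C : Cplx R) ^+ k : Cplx R) by apply/funext => k; exact: aE.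
  exact.
(* The point d/2 lies inside the interval of convergence, so its series has bounded terms and the
   estimate holds for |l| <= d/4. *)
have l00 : d / 2 != 0 by rewrite gt_eqF// divr_gt0.
have cl0 : cvgn (series (fun k => a k * ((d / 2)%:C%C : Cplx R) ^+ k : Cplx R)).
  apply: cvgP; apply: Ha; rewrite gtr0_norm ?divr_gt0//.
  by rewrite ltr_pdivrMr// ltr_pMr// ltr1n.
have [n] := ubnP j; elim: n j => // n IH j; rewrite ltnS => jn.
have [C1 h1] := power_series_taylor j.+1 l00 cl0.
have [C2 h2] := charge_gf_taylor j.+1.
apply/esym/eqP; rewrite -subr_eq0; apply/eqP.
apply: (@small_eq0 _ _ (j`!%:R * (C1 + C2)) j); near=> l.
have ld : `|l| < d by near: l; exact: dnbhs0_lt.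
have ld2 : `|l| <= `|d / 2| / 2.
  by near: l; apply: dnbhs0_le; rewrite divr_gt0// normr_gt0.
have E1 := h1 l _ ld2 (Ha l ld).
have E2 := h2 l.
have E : (('i%C * l%:C%C) ^+ j / j`!%:R) * (moment_sum j - m j) =
   (charge_gf ip v H Q t l - \sum_(i < j.+1) a i * (l%:C%C : Cplx R) ^+ i) -
   (charge_gf ip v H Q t l -
     \sum_(i < j.+1) (('i%C * l%:C%C) ^+ i / i`!%:R) * moment_sum i) :> R[i].
  have -> : forall x y z : R[i], x - y - (x - z) = z - y by move=> x y z; ring.
  rewrite -sumrB big_ord_recr/=.
  rewrite big1 ?add0r; first by rewrite -aE mulrBr.
  by move=> i _; rewrite -aE IH ?subrr// (leq_trans (ltn_ord i)).
have nE : `|(('i%C * l%:C%C) ^+ j / j`!%:R) * (moment_sum j - m j)| <=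
    ((C1 + C2) * `|l| ^+ j.+1)%:C%C.
  rewrite E (le_trans (ler_normB _ _))// mulrDl rmorphD/= lerD//.
move: nE; rewrite normrM normrM normfV normr_nat normrX norm_iR.
have f0 : 0 < j`!%:R :> R[i] by rewrite ltr0n fact_gt0.
rewrite mulrAC ler_pdivrMr// mulrC rmorphXn/= => /le_trans; apply.
rewrite -(rmorph_nat (real_complex R)) -rmorphM lecR le_eqVlt; apply/orP; left; apply/eqP; ring.
Unshelve. all: by end_near.
Qed.

End GeneratingFunction.

Theorem mainTheorem1 (R : realType) (V : completeNormedModType R[i])
    (ip : {dot V for Num.conj}) (H Q : operator V) (v : nat -> V)
    (t : R) (m : nat -> R[i]) :
  hilbert ip ->
  selfadjoint ip H -> selfadjoint ip Q ->
  expi_exists ip H -> expi_exists ip Q ->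
  state ip v ->
  TQ_well_defined ip v (heisenberg ip H Q) ->
  Tstar_well_defined ip v (heisenberg ip H Q) ->
  0 < t ->
  has_moments (charge_gf ip v H Q t) m ->
  forall k : nat, (1 <= k)%N ->
  forall (nu : {measure set (borel_rV k) -> \bar R}) (h : 'rV[R]_k -> R[i]),
  distribution_is_measure
    (fun phi => expect ip v (Tstar ip (heisenberg ip H Q) phi)) nu h ->
  m k = cintegral nu (time_box t) h.
Proof.
move=> hip _ saQ exH exQ _ TQw Tsw t0 hm k _ nu h dm.
rewrite (has_moments_unique hip saQ exH exQ TQw t0 k hm).
rewrite (radon_corner TQw Tsw t0 dm).
have [beta cb mb] := ordered_moment_bound exH TQw t0 k.
have cv := cplx_series_cvg mb cb.
rewrite /moment_sum (cvg_lim (@norm_hausdorff _ _) cv).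
by congr (limn (series _) +i* limn (series _))%C; apply/funext => n;
  rewrite ordered_moment_corner.
Qed.
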